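(* The finite-arc variational values $\Lambda_M$ converge to the Lebesgue universal covering constant: $$\lim_{M\to\infty}\Lambda_M=a_{\mathrm{Leb}}.$$
   Context: $\mathcal E(2)$ is the group of all Euclidean isometries of $\mathbb R^2$ (including reflections). A compact convex set $U\subset\mathbb R^2$ is a universal cover if for every nonempty compact $K\subset\mathbb R^2$ with $\operatorname{diam}(K)\le1$ there is $g\in\mathcal E(2)$ with $gK\subset U$. $a_{\mathrm{Leb}}$ is the infimum of $\operatorname{area}(U)$ (two-dimensional Lebesgue measure) over all compact convex universal covers $U$. A convex body is a compact convex subset of $\mathbb R^2$ with nonempty interior. For a compact convex $K$, $h_K(\theta)=\max_{x\in K}\langle x,(\cos\theta,\sin\theta)\rangle$ is its support function. $\mathcal W_1$ is the set of convex bodies of constant width $1$, i.e. $h_K(\theta)+h_K(\theta+\pi)=1$ for all $\theta$. For $K\in\mathcal W_1$, the distribution $h_K+h_K''$ on the circle $\mathbb R/2\pi\mathbb Z$ is a measure absolutely continuous with respect to Lebesgue measure; its density is denoted $\rho_K$ and satisfies $\rho_K(\theta)+\rho_K(\theta+\pi)=1$ a.e. For odd $n\ge3$, $\mathcal R_n$ is the set of all $K\in\mathcal W_1$ such that $\rho_K$ is (a.e. equal to) a $0/1$-valued step function with finitely many pieces for which $\{\rho_K=1\}$ has exactly $n$ connected components on the circle, counted after choosing a finite-interval representative, deleting zero-length intervals and merging adjacent intervals. Let $D=\{x\in\mathbb R^2:|x|\le1/2\}$ and, for integers $M\ge1$, $\mathcal A_M=\{D\}\cup\bigcup_{m=1}^M\mathcal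 R_{2m+1}$. $\Lambda_M$ is the infimum of $\operatorname{area}(U)$ over all compact convex $U\subset\mathbb R^2$ such that for every $K\in\mathcal A_M$ there is $g\in\mathcal E(2)$ with $gK\subset U$. *)

(* Defs.v *)
From mathcomp Require Import all_boot all_order all_algebra.
From mathcomp Require Import all_classical all_reals all_analysis.

Set Implicit Arguments.
Unset Strict Implicit.
Unset Printing Implicit Defensive.

Import Order.TTheory GRing.Theory Num.Theory.
Import numFieldNormedType.Exports.

Local Open Scope classical_set_scope.
Local Open Scope ring_scope.

(* The library norm on a product type is the sup norm, so the Euclidean
   distance is defined here; the topology is the product topology. *)
Notation plane R := (R^o * R^o)%type.

Definition dotp (R : realType) (x y : plane R) : R := x.1 * y.1 + x.2 * y.2.

Definition eucl_dist (R : realType) (x y : plane R) : R :=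
  Num.sqrt (dotp (x - y) (x - y)).

(* Distance-preserving self-maps of the plane are automatically bijective. *)
Definition isometry (R : realType) (g : plane R -> plane R) : Prop :=
  forall x y, eucl_dist (g x) (g y) = eucl_dist x y.

Definition diam (R : realType) (A : set (plane R)) : \bar R :=
  ereal_sup [set (eucl_dist p.1 p.2)%:E | p in A `*` A].

Definition area (R : realType) (A : set (plane R)) : \bar R :=
  (@lebesgue_measure R \x @lebesgue_measure R)%E A.

Definition covers (R : realType) (F : set (set (plane R)))
    (U : set (plane R)) : Prop :=
  forall K, F K -> exists2 g : plane R -> plane R, isometry g & g @` K `<=` U.

Definition cover_value (R : realType) (F : set (set (plane R))) : \bar R :=
  ereal_inf [set area U | U in
    [set U : set (plane R) | [/\ compact U, convex_set U & covers F U]]].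

Definition a_Leb (R : realType) : \bar R :=
  cover_value
    [set K : set (plane R) | [/\ K !=set0, compact K & (diam K <= 1)%E]].

Definition convex_body (R : realType) (K : set (plane R)) : Prop :=
  [/\ compact K, convex_set K & K° !=set0].

Definition udir (R : realType) (t : R) : plane R := (cos t, sin t).

(* On a nonempty compact set the supremum is a maximum. *)
Definition support_fun (R : realType) (K : set (plane R)) (t : R) : R :=
  sup [set dotp x (udir t) | x in K].

Definition W1 (R : realType) : set (set (plane R)) :=
  [set K | convex_body K /\
     forall t, support_fun K t + support_fun K (t + pi) = 1].

Definition smooth (R : realType) (f : R -> R) : Prop :=
  forall (n : nat) (t : R), derivable (derive1n n (f : R -> R^o)) t 1.

(* rho is a density of the distribution h_K + h_K'' on the circle: functions on
   the circle are 2 pi-periodic functions on the line, and the second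
   derivative is moved to the test function.  Such a rho is unique up to a.e.
   equality. *)
Definition is_rho (R : realType) (K : set (plane R)) (rho : R -> R) : Prop :=
  [/\ periodic rho (pi *+ 2),
      (@lebesgue_measure R).-integrable `[0, pi *+ 2] (EFin \o rho)
    & forall phi : R -> R, smooth phi -> periodic phi (pi *+ 2) ->
        (\int[@lebesgue_measure R]_(t in `[0%R, (pi *+ 2)%R])
           (support_fun K t * (phi t + derive1n 2 (phi : R -> R^o) t)))%R =
        (\int[@lebesgue_measure R]_(t in `[0%R, (pi *+ 2)%R])
           (rho t * phi t))%R].

(* The union, on the unit circle, of the closed arcs with angular endpoints
   listed in s. *)
Definition arcs (R : realType) (s : seq (R * R)) : set (plane R) :=
  \bigcup_(ab in [set` s]) (@udir R @` `[ab.1, ab.2]).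

(* Up to null sets, a subset of the circle with finitely many pieces is a finite
   union of arcs.  Taking only closed arcs of positive length deletes the
   zero-length intervals, and adjacent arcs then share an endpoint, hence lie in
   the same connected component. *)
Definition Rn (R : realType) (n : nat) : set (set (plane R)) :=
  [set K | W1 K /\ exists (rho : R -> R) (s : seq (R * R)),
     [/\ is_rho K rho,
         (forall ab, ab \in s -> ab.1 < ab.2),
         {ae @lebesgue_measure R, forall t, rho t = \1_(arcs s) (udir t)}
       & ([set connected_component (arcs s) x | x in arcs s] #= `I_n)%card]].

Definition disk (R : realType) : set (plane R) :=
  [set x | eucl_dist x 0 <= 2^-1].

Definition AM (R : realType) (M : nat) : set (set (plane R)) :=
  [set @disk R] `|` \bigcup_(m in [set m | (1 <= m <= M)%N]) @Rn R (m.*2.+1).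

Definition Lambda (R : realType) (M : nat) : \bar R :=
  cover_value (@AM R M).

(* Main.v *)
Require Import Defs.
From mathcomp Require Import all_boot all_order all_algebra.
From mathcomp Require Import all_classical all_reals all_analysis.
From mathcomp Require Import measurable_realfun.
From mathcomp Require Import ring lra zify.
Import Order.TTheory GRing.Theory Num.Theory.
Import numFieldNormedType.Exports.
Local Open Scope classical_set_scope.
Local Open Scope ring_scope.

(** Trivially [Lambda R M <= a_Leb R], since every member of [AM M] is compact of
    diameter at most [1].  Conversely, every [K] of diameter at most [1] satisfies
    [kappa K <= K'] for some Reuleaux polygon [K'] with [2N + 1] arcs, where
    [kappa = (1 - e) cos (pi / 2N)] does not depend on [K].  Hence, if [U] covers
    [AM M] with [N <= M], then [kappa^-1 U] is a universal cover, so that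
    [kappa^2 a_Leb <= Lambda M <= a_Leb].

    To build [K'], look at the support numbers of [K] in [2N] equally spaced
    directions.  Maximal enlargements of these numbers that remain the support
    numbers of a polygon of width at most [1] have width exactly [1]: otherwise
    both edges orthogonal to a direction [i] of minimal width [w(i)] are
    degenerate, so that [w(i-1) + w(i+1) = 2 cos d w(i)], where [d = pi / N],
    against minimality.  After mixing with a disk all edges are nondegenerate.
    Opposite edges then have lengths [2 tan (d/2) rho] and
    [2 tan (d/2) (1 - rho)] with [0 < rho < 1].  Shrinking the polygon by
    [cos (d/2)] and replacing an edge by an arc of radius [1] with the same chord
    on one side, and by two arcs separated by a vertex on the other, gives [K']. *)

Set Implicit Arguments.
Unset Strict Implicit.
Unset Printing Implicit Defensive.

(** * The Euclidean plane *)

Section plane_geometry.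
Variable R : realType.
Implicit Types (x y z : plane R) (s t : R) (K : set (plane R)).

Lemma dotpDl x y z : dotp (x + y) z = dotp x z + dotp y z.
Proof. by rewrite /dotp /=; ring. Qed.

Lemma dotpNl x z : dotp (- x) z = - dotp x z.
Proof. by rewrite /dotp /=; ring. Qed.

Lemma dotpBl x y z : dotp (x - y) z = dotp x z - dotp y z.
Proof. by rewrite dotpDl dotpNl. Qed.

Lemma dotpZl (a : R) x z : dotp (a *: x) z = a * dotp x z.
Proof. by rewrite /dotp /=; rewrite /GRing.scale /=; ring. Qed.

Lemma dotpC x y : dotp x y = dotp y x.
Proof. by rewrite /dotp /=; ring. Qed.

Lemma dotp_udir s t : dotp (udir s) (udir t) = cos (s - t).
Proof. by rewrite cosB. Qed.

Lemma udirDpi t : udir (t + pi) = - udir t.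
Proof. by rewrite /udir cosDpi sinDpi. Qed.

Lemma udirD2pi t : udir (t + pi *+ 2) = udir t.
Proof. by rewrite /udir cosD2pi sinD2pi. Qed.

Lemma continuous_dotp z : continuous (fun x : plane R => dotp x z).
Proof.
move=> x; rewrite /dotp; apply: cvgD; apply: cvgMr_tmp.
  exact: cvg_fst.
exact: cvg_snd.
Qed.

Lemma closed_halfplane z (c : R) : closed [set x | dotp x z <= c].
Proof.
have -> : [set x | dotp x z <= c] = (fun x : plane R => dotp x z) @^-1` [set r | r <= c] by [].
by apply: closed_comp; [move=> x _; exact: continuous_dotp|exact: closed_le].
Qed.

Lemma compact_plane K (C : R) : closed K ->
  (forall x, K x -> `|x.1| <= C /\ `|x.2| <= C) -> compact K.
Proof.
move=> cK bK; apply: (@subclosed_compact _ _ (`[- C, C] `*` `[- C, C])) => //.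
  by apply: compact_setX; exact: segment_compact.
by move=> x /bK []; rewrite !ler_norml => h1 h2; split; rewrite /= in_itv.
Qed.

Lemma closed_compact_plane K : compact K -> closed K.
Proof.
by apply: compact_closed; exact: norm_hausdorff.
Qed.

Lemma convex_planeP K : convex_set K <->
  forall x y (a : R), K x -> K y -> 0 <= a <= 1 -> K (a *: x + (1 - a) *: y).
Proof.
split => [cK x y a Kx Ky a01|cK x y l].
  have [p] : exists p : {i01 R}, p%:num = a.
    by case/andP: a01 => a0 a1; exists (Itv01 a0 a1).
  by move=> <-; have := cK x y p; rewrite !inE => /(_ Kx Ky).
rewrite !inE => Kx Ky; apply: cK => //.
by rewrite ge0 le1.
Qed.

Lemma support_fun_max K t : compact K -> K !=set0 ->
  exists2 x, K x & support_fun K t = dotp x (udir t) /\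
    forall y, K y -> dotp y (udir t) <= dotp x (udir t).
Proof.
move=> cK K0; have [|x] := @compact_EVT_max _ _ (fun x : plane R => dotp x (udir t)) _ K0 cK.
  by apply: continuous_subspaceT; exact: continuous_dotp.
rewrite inE => Kx xmax; exists x => //; split; last first.
  by move=> y Ky; apply: xmax; rewrite inE.
apply/eqP; rewrite eq_le; apply/andP; split.
  apply: ge_sup; first by exists (dotp x (udir t)), x.
  by move=> _ [y Ky <-]; apply: xmax; rewrite inE.
apply: ub_le_sup; last by exists x.
by exists (dotp x (udir t)) => _ [y Ky <-]; apply: xmax; rewrite inE.
Qed.

Lemma support_fun_eq K t x : K x ->
  (forall y, K y -> dotp y (udir t) <= dotp x (udir t)) ->
  support_fun K t = dotp x (udir t).
Proof.
move=> Kx xmax; apply/eqP; rewrite eq_le; apply/andP; split.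
  apply: ge_sup; first by exists (dotp x (udir t)), x.
  by move=> _ [y Ky <-]; apply: xmax.
apply: ub_le_sup; last by exists x.
by exists (dotp x (udir t)) => _ [y Ky <-]; apply: xmax.
Qed.

Lemma support_fun_ge K t x : compact K -> K x ->
  dotp x (udir t) <= support_fun K t.
Proof.
by move=> cK Kx; have [|y Ky [-> ymax]] := support_fun_max t cK; [exists x|apply: ymax].
Qed.

Lemma dotp_udir_le x t : dotp x (udir t) <= Num.sqrt (dotp x x).
Proof.
rewrite (le_trans (ler_norm _))// -sqrtr_sqr ler_wsqrtr// /dotp/udir/=.
(* Lagrange's identity: the defect in the Cauchy-Schwarz inequality is the squared component of [x]
   orthogonal to [udir t]. *)
rewrite -subr_ge0; have -> : x.1 * x.1 + x.2 * x.2
    - (x.1 * cos t + x.2 * sin t) ^+ 2 = (x.1 * sin t - x.2 * cos t) ^+ 2.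
  rewrite -[x.1 * x.1 + _]mulr1 -(cos2Dsin2 t); ring.
exact: sqr_ge0.
Qed.

End plane_geometry.

(** * Reuleaux polygons *)

Lemma seq_cover (R : realType) (f : nat -> R) t m :
  (forall k, f k <= f k.+1) -> f 0 <= t -> t <= f m -> exists k, f k <= t <= f k.+1.
Proof.
move=> f_le t0; elim: m => [|m IH] tm; first by exists 0%N; rewrite t0 (le_trans tm).
by have [/IH//|mt] := leP t (f m); exists m; rewrite tm ltW.
Qed.

Section reuleaux_polygon.
Variables (R : realType) (n : nat) (b : nat -> R) (q : nat -> plane R).
Hypotheses (n_odd : odd n) (b0 : b 0 = 0) (b_lt : forall k, b k < b k.+1).
Hypothesis b_per : forall k, b (k + n) = b k + pi.
Hypothesis q_step : forall k, q k.+1 = q k + (-1) ^+ k.+1 *: udir (b k.+1).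
Hypothesis q_per0 : q n = q 0.
Implicit Types (s t : R) (j k : nat).


(** For even [k] the point [q k] is a vertex with normal angles from [b k] to [b k.+1]; for odd [k]
    it is the centre of a unit arc with these normal angles. One formula thus parametrizes the whole
    boundary by the normal angle. *)
Definition boundary_point k t : plane R := q k + (odd k)%:R *: udir t.

(** Half-planes instead of the curve, so that closedness and convexity are immediate. Only angles
    [t >= 0] occur, which already cover every direction. *)
Definition reuleaux : set (plane R) :=
  [set y | forall k t, b k <= t <= b k.+1 ->
    dotp y (udir t) <= dotp (q k) (udir t) + (odd k)%:R].

(** Over a half turn [udir (b k)] changes sign, and so does [(-1) ^+ k] because [n] is odd; hence
    the steps of [q] repeat. *)
Lemma center_periodic k : q (k + n) = q k.
Proof.
elim: k => [|k IH]; first by rewrite add0n q_per0.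
rewrite addSn 2!q_step IH -addSn b_per udirDpi; congr (_ + _).
by rewrite exprD -[(-1) ^+ n]signr_odd n_odd expr1 mulrN1 scaleNr scalerN opprK.
Qed.

Lemma odd_flip k : odd (k + n) = ~~ odd k.
Proof. by rewrite oddD n_odd addbT. Qed.

Lemma break_homo j k : (j <= k)%N -> b j <= b k.
Proof. by move=> jk; apply: (homo_leq (@lexx _ _) le_trans) jk => i; exact/ltW. Qed.

Lemma break_mul m : b (m * n) = pi *+ m.
Proof.
by elim: m => [|m IH]; rewrite ?mul0n// mulSn addnC b_per IH mulrSr.
Qed.

Lemma archi_pi t : exists m, t <= pi *+ m.
Proof.
exists (Num.bound `|t|); rewrite -mulr_natr.
apply: le_trans (ler_norm t) _; apply: le_trans (ltW (archi_boundP _)) _ => //.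
by rewrite ler_peMl// (le_trans _ (pi_ge2 R))// ler1n.
Qed.

Lemma break_cover t : 0 <= t -> exists k, b k <= t <= b k.+1.
Proof.
move=> t0; have [m tm] := archi_pi t.
by apply: (@seq_cover _ _ _ (m * n)%N); rewrite ?b0 ?break_mul// => k; exact/ltW.
Qed.

Lemma boundary_step k : boundary_point k.+1 (b k.+1) = boundary_point k (b k.+1).
Proof.
rewrite /boundary_point q_step -addrA -scalerDl; congr (_ + _ *: _).
by rewrite -signr_odd /=; case: (odd k); rewrite /= ?expr0 ?expr1 ?addr0 ?addNr.
Qed.

Lemma le_cos s t : 0 <= s -> s <= t -> t <= pi -> cos t <= cos s.
Proof.
move=> s0 st tpi; have [->//|neq] := eqVneq s t; apply: ltW.
by rewrite ltr_cos ?in_itv/= ?lt_neqAle ?neq ?st ?s0 ?tpi ?(le_trans s0)// ?(le_trans st).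
Qed.

Lemma dotp_boundary j s t :
  dotp (boundary_point j s) (udir t) = dotp (q j) (udir t) + (odd j)%:R * cos (s - t).
Proof. by rewrite dotpDl dotpZl dotp_udir. Qed.

(** While the normal angle rises from [t - pi] to [t], the height in direction [udir t] does not
    decrease: inside a cell only the term with [cos (s - t)] changes, and consecutive cells share
    their break point by [boundary_step]. *)
Lemma boundary_le_before j k s s' t : (j <= k)%N ->
  b j <= s <= b j.+1 -> b k <= s' <= b k.+1 -> s <= s' -> s' <= t -> t <= s + pi ->
  dotp (boundary_point j s) (udir t) <= dotp (boundary_point k s') (udir t).
Proof.
move=> jk; have [m ->] : exists m, k = (j + m)%N by exists (k - j)%N; lia.
have cell i r r' : r <= r' -> r' <= t -> t <= r + pi ->
    dotp (boundary_point i r) (udir t) <= dotp (boundary_point i r') (udir t).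
  move=> rr' r't tr; rewrite !dotp_boundary lerD2l ler_wpM2l//.
  by rewrite -(cosN (r - t)) -(cosN (r' - t)) le_cos//; lra.
elim: m j s {k jk} => [|m IH] j s; rewrite ?addn0 => sj s'k ss' s't ts.
  exact: cell.
rewrite -addSnnS in s'k *.
have bs' : b j.+1 <= s'.
  by case/andP: s'k => + _; apply: le_trans; rewrite break_homo//; lia.
apply: (@le_trans _ _ (dotp (boundary_point j (b j.+1)) (udir t))).
  by apply: cell; [case/andP: sj|lra|lra].
rewrite -boundary_step; apply: IH => //.
- by rewrite lexx ltW.
- by case/andP: sj; lra.
Qed.

(** Mirror image of [boundary_le_before]: the height does not increase while the normal angle rises
    from [t] to [t + pi]. *)
Lemma boundary_le_after j k s s' t : (j <= k)%N ->
  b j <= s <= b j.+1 -> b k <= s' <= b k.+1 -> s <= s' -> t <= s -> s' <= t + pi ->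
  dotp (boundary_point k s') (udir t) <= dotp (boundary_point j s) (udir t).
Proof.
move=> jk; have [m ->] : exists m, k = (j + m)%N by exists (k - j)%N; lia.
have cell i r r' : r <= r' -> t <= r -> r' <= t + pi ->
    dotp (boundary_point i r') (udir t) <= dotp (boundary_point i r) (udir t).
  move=> rr' r't tr; rewrite !dotp_boundary lerD2l ler_wpM2l//.
  by rewrite le_cos//; lra.
elim: m j s {k jk} => [|m IH] j s; rewrite ?addn0 => sj s'k ss' s't ts.
  exact: cell.
rewrite -addSnnS in s'k *.
have bs' : b j.+1 <= s'.
  by case/andP: s'k => + _; apply: le_trans; rewrite break_homo//; lia.
apply: (@le_trans _ _ (dotp (boundary_point j (b j.+1)) (udir t))).
  rewrite -boundary_step; apply: IH => //.
  - by rewrite lexx ltW.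
  - by case/andP: sj; lra.
by apply: cell; [case/andP: sj|lra|lra].
Qed.

Lemma boundary_max_near j k s t :
  b j <= s <= b j.+1 -> b k <= t <= b k.+1 -> `|s - t| <= pi ->
  dotp (boundary_point j s) (udir t) <= dotp (boundary_point k t) (udir t).
Proof.
move=> sj tk; rewrite ler_norml => /andP[st1 st2].
have [st|ts] := leP s t.
  have [jk|kj] := leqP j k; first by apply: boundary_le_before => //; lra.
  (* Cells in the wrong order can meet only at a common break, which forces [s = t]. *)
  have bkj := break_homo kj.
  have Est : s = t by case/andP: sj; case/andP: tk; lra.
  by apply: boundary_le_after => //; rewrite ?Est//; [exact: ltnW|lra..].
have [kj|jk] := leqP k j; first by apply: boundary_le_after => //; lra.
by have := break_homo jk; case/andP: sj; case/andP: tk; lra.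
Qed.

Lemma boundary_periodic k t :
  boundary_point (k + n + n) (t + pi *+ 2) = boundary_point k t.
Proof. by rewrite /boundary_point !center_periodic udirD2pi !odd_flip negbK. Qed.

Lemma break_periodic k : b (k + n + n) = b k + pi *+ 2.
Proof. by rewrite !b_per -addrA. Qed.

Lemma boundary_max j k s t : b j <= s <= b j.+1 -> b k <= t <= b k.+1 ->
  dotp (boundary_point j s) (udir t) <= dotp (boundary_point k t) (udir t).
Proof.
(* The angular distance is bounded by an odd multiple of [pi]. Advancing the smaller angle by a full
   turn, that is by [n + n] cells, lowers the bound by [pi *+ 2] until the near case applies. *)
have [m] : exists m, `|s - t| <= pi *+ m.*2.+1.
  have [m tm] := archi_pi `|s - t|; exists m.
  apply: le_trans tm _; rewrite ler_wpMn2l ?pi_ge0//.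
  by lia.
elim: m j k s t => [|m IH] j k s t stm sj tk.
  exact: boundary_max_near.
have pi0 := pi_gt0 R.
have [st|st] := leP (`|s - t|) pi; first exact: boundary_max_near.
have cellD i r : b i <= r <= b i.+1 ->
    b (i + n + n) <= r + pi *+ 2 <= b (i + n + n).+1.
  by rewrite -!addSn !break_periodic !lerD2r.
have [s_t|t_s] := leP s t.
  rewrite -(boundary_periodic j s); apply: IH => //; last exact: cellD.
  move: stm st; rewrite distrC ger0_norm ?subr_ge0// => stm st.
  rewrite ler_norml; apply/andP; split.
    by move: stm; rewrite doubleS -addn2 mulrnDr; lra.
  have : 0 <= (pi : R) *+ m.*2 by rewrite mulrn_wge0// ltW.
  by rewrite mulrS; lra.
rewrite -(boundary_periodic k t) -(udirD2pi t); apply: IH => //; last exact: cellD.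
move: stm st; rewrite gtr0_norm ?subr_gt0// => stm st.
rewrite ler_norml; apply/andP; split; last first.
  by move: stm; rewrite doubleS -addn2 mulrnDr; lra.
have : 0 <= (pi : R) *+ m.*2 by rewrite mulrn_wge0// ltW.
by rewrite mulrS; lra.
Qed.

Lemma boundary_in_reuleaux j s : b j <= s <= b j.+1 -> reuleaux (boundary_point j s).
Proof.
move=> sj k t tk; rewrite (le_trans (boundary_max sj tk))//.
by rewrite dotp_boundary subrr cos0 mulr1.
Qed.

Lemma support_reuleaux k t : b k <= t <= b k.+1 ->
  support_fun reuleaux t = dotp (q k) (udir t) + (odd k)%:R.
Proof.
move=> tk; rewrite (support_fun_eq (boundary_in_reuleaux tk)).
  by rewrite dotp_boundary subrr cos0 mulr1.
by move=> y /(_ _ _ tk); rewrite dotp_boundary subrr cos0 mulr1.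
Qed.

Lemma support_funD2pi (K : set (plane R)) t m :
  support_fun K (t + (pi *+ 2) *+ m) = support_fun K t.
Proof.
elim: m => [|m IH]; first by rewrite addr0.
by rewrite mulrSr addrA -IH /support_fun udirD2pi.
Qed.

(** Opposite cells [k] and [k + n] have the same [q] and opposite parity: the linear terms cancel
    and exactly one of the two constants is [1]. *)
Lemma width_reuleaux t :
  support_fun reuleaux t + support_fun reuleaux (t + pi) = 1.
Proof.
wlog t0 : t / 0 <= t => [H|].
  have [m tm] := archi_pi (- t).
  rewrite -(support_funD2pi _ t m) -(support_funD2pi _ (t + pi) m) addrAC; apply: H.
  have P0 : 0 <= pi *+ m :> R by rewrite mulrn_wge0 ?pi_ge0.
  rewrite mulrnAC mulr2n; move: tm P0; move: (pi *+ m) => P; lra.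
have [k tk] := break_cover t0.
have tk' : b (k + n) <= t + pi <= b (k + n).+1.
  by rewrite -addSn !b_per !lerD2r.
rewrite (support_reuleaux tk) (support_reuleaux tk') center_periodic udirDpi.
rewrite odd_flip -[- udir t]scaleN1r [dotp (q k) (_ *: _)]dotpC dotpZl [dotp (udir t) _]dotpC.
by case: (odd k) => /=; lra.
Qed.

Lemma closed_reuleaux : closed reuleaux.
Proof.
have -> : reuleaux = \bigcap_(kt in [set kt : nat * R | b kt.1 <= kt.2 <= b kt.1.+1])
    [set y | dotp y (udir kt.2) <= dotp (q kt.1) (udir kt.2) + (odd kt.1)%:R].
  apply/seteqP; split => [y Ky [k t] /= tk|y Ky k t tk]; first exact: Ky.
  exact: (Ky (k, t)).
by apply: closed_bigI => kt _; exact: closed_halfplane.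
Qed.

Lemma convex_reuleaux : convex_set reuleaux.
Proof.
apply/convex_planeP => x y a Kx Ky a01 k t tk.
have := Kx _ _ tk; have := Ky _ _ tk; rewrite dotpDl !dotpZl.
move: (dotp x _) (dotp y _) (_ + _) => X Y c; case/andP: a01 => a0 a1; nra.
Qed.

Lemma compact_reuleaux : compact reuleaux.
Proof.
(* The half-planes at the angles [0], [pi / 2], [pi] and [pi / 2 + pi] confine the set to a box. *)
have [k0 h0] := @break_cover 0 (lexx _).
have [k1 h1] := @break_cover (pi / 2) (divr_ge0 (pi_ge0 R) (ler0n _ 2)).
have [k2 h2] := @break_cover (0 + pi) (addr_ge0 (lexx _) (pi_ge0 R)).
have [k3 h3] := @break_cover (pi / 2 + pi)
  (addr_ge0 (divr_ge0 (pi_ge0 R) (ler0n _ 2)) (pi_ge0 R)).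
pose h k t := dotp (q k) (udir t) + (odd k)%:R.
apply: (@compact_plane _ _ (`|h k0 0| + `|h k1 (pi / 2)| + `|h k2 (0 + pi)| +
  `|h k3 (pi / 2 + pi)|)) closed_reuleaux _ => y Ky.
have /= := Ky _ _ h0; have /= := Ky _ _ h1; have /= := Ky _ _ h2; have /= := Ky _ _ h3.
rewrite -/(h k3 _) -/(h k2 _) -/(h k1 _) -/(h k0 _).
rewrite /dotp/udir/= !cosDpi !sinDpi cos0 sin0 cos_pihalf sin_pihalf.
move: (h k0 _) (h k1 _) (h k2 _) (h k3 _) => H0 H1 H2 H3.
have := ler_norm H0; have := ler_norm H1; have := ler_norm H2; have := ler_norm H3.
have := normr_ge0 H0; have := normr_ge0 H1; have := normr_ge0 H2; have := normr_ge0 H3.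
move: `|H0| `|H1| `|H2| `|H3| => N0 N1 N2 N3 *.
by rewrite !ler_norml; split; lra.
Qed.

Lemma W1_reuleaux : reuleaux° !=set0 -> W1 reuleaux.
Proof.
move=> K0; split; last exact: width_reuleaux.
by split => //; [exact: compact_reuleaux|exact: convex_reuleaux].
Qed.

End reuleaux_polygon.

(** * Connected components of unions of arcs *)

(** Finitely many disjoint closed pieces are clopen in their union, so a component cannot leave the
    piece in which it starts. *)
Lemma components_closed_cover (T : topologicalType) (n : nat) (A : nat -> set T) :
  (forall i, (i < n)%N -> A i !=set0) -> (forall i, (i < n)%N -> connected (A i)) ->
  (forall i, (i < n)%N -> closed (A i)) -> trivIset `I_n A ->
  ([set connected_component (\bigcup_(i in `I_n) A i) x | x in
    \bigcup_(i in `I_n) A i] #= `I_n)%card.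
Proof.
move=> A0 Aconn Acl Adisj; set U := \bigcup_(i in _) _.
have compE i x : (i < n)%N -> A i x -> connected_component U x = A i.
  move=> ilt Aix; apply/seteqP; split; last first.
    by apply: connected_component_max => //; [exact: bigcup_sup|exact: Aconn].
  have Ux : U x by exists i.
  have : connected (connected_component U x) by exact: component_connected.
  move=> /(_ (connected_component U x `&` A i)) <-; first exact: subIsetr.
  - by exists x; split => //; exact: connected_component_refl.
  - exists (~` \bigcup_(j in [set j | (j < n)%N && (j != i)]) A j).
      rewrite openC; apply: closed_bigcup => [|j /andP[jn _]]; last exact: Acl.
      by apply: sub_finite_set (finite_II n) => j /= /andP[].
    apply/seteqP; split => [y [cy Aiy]|y [cy nAy]]; split => //.
      move=> [j /andP[jn ji] Ajy]; move/eqP: ji; apply.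
      by apply: Adisj => //; exists y.
    have [j jn Ajy] := connected_component_sub cy.
    have [<-//|ji] := eqVneq j i; exfalso; apply: nAy; exists j => //=.
    by rewrite jn ji.
  - by exists (A i) => //; exact: Acl.
have -> : [set connected_component U x | x in U] = A @` `I_n.
  apply/seteqP; split => [_ [x [i ilt Aix] <-]|_ [i ilt <-]].
    by exists i => //; rewrite (compE i).
  have [x Aix] := A0 _ ilt; exists x; [by exists i|exact: compE].
apply: inj_card_eq => i j; rewrite !inE => ilt jlt Aij.
by have [x Aix] := A0 _ ilt; apply: Adisj => //; exists x; split=> //; rewrite -Aij.
Qed.

(** Here [cos (s - t) = 1], and the half-angle formula turns this into [sin (|s - t| / 2) = 0],
    impossible for a nonzero distance below a full turn. *)
Lemma udir_inj (R : realType) (s t : R) :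
  `|s - t| < pi *+ 2 -> udir s = udir t -> s = t.
Proof.
move=> st Est; have cos1 : cos (s - t) = 1 by rewrite -dotp_udir Est dotp_udir subrr cos0.
apply: contrapT => /eqP neq.
have d0 : 0 < `|s - t| by rewrite normr_gt0 subr_eq0.
have : 0 < sin (`|s - t| / 2).
  by apply: sin_gt0_pi; move: st; rewrite mulr2n; lra.
have : cos (`|s - t| / 2 *+ 2) = 1 by rewrite -mulr_natr divfK// cos_norm.
rewrite cos_mulr2n cos2sin2 mulr2n; nra.
Qed.

Lemma continuous_udir (R : realType) : continuous (@udir R).
Proof.
move=> t; apply: (@cvg_pair _ _ _ (nbhs t) (nbhs (cos t)) (nbhs (sin t)) _ _ _ cos sin).
  exact: continuous_cos.
exact: continuous_sin.
Qed.

Section reuleaux_arcs.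
Variables (R : realType) (n : nat) (b : nat -> R).
Hypotheses (b0 : b 0 = 0) (b_lt : forall k, b k < b k.+1).
Hypothesis b_per : forall k, b (k + n) = b k + pi.
Implicit Types (s t : R) (j k : nat).

(** The odd cells of one full turn of [n.*2] cells; they carry curvature density one. *)
Definition one_arcs := [seq (b i.*2.+1, b i.*2.+2) | i <- iota 0 n].

Lemma one_arcsE :
  arcs one_arcs = \bigcup_(i in `I_n) (@udir R @` `[b i.*2.+1, b i.*2.+2]).
Proof.
apply/seteqP; split => [x [_ /= /mapP[i + ->] xi]|x [i ilt xi]].
  by rewrite mem_iota/= => ilt; exists i.
by exists (b i.*2.+1, b i.*2.+2) => //=; apply/mapP; exists i => //; rewrite mem_iota.
Qed.

Lemma one_arcs_lt ab : ab \in one_arcs -> ab.1 < ab.2.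
Proof. by rewrite /one_arcs => /mapP[i _ ->]; exact: b_lt. Qed.

Lemma break_last : b n.*2 = pi *+ 2.
Proof. by rewrite -addnn b_per -(add0n n) b_per b0 add0r. Qed.

(** The first arc begins at [b 1 > 0], so all arcs lie in a half-open turn, where [udir] is
    injective; in particular the last arc does not touch the first. *)
Lemma break_arc i t : (i < n)%N -> b i.*2.+1 <= t <= b i.*2.+2 -> 0 < t <= pi *+ 2.
Proof.
move=> ilt /andP[t1 t2]; apply/andP; split.
  apply: lt_le_trans t1; rewrite -b0; apply: (lt_le_trans (b_lt 0)).
  exact: break_homo.
by apply: le_trans t2 _; rewrite -break_last; apply: (break_homo b_lt); lia.
Qed.

Lemma one_arcs_components :
  ([set connected_component (arcs one_arcs) x | x in arcs one_arcs] #= `I_n)%card.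
Proof.
rewrite one_arcsE; apply: components_closed_cover => [i ilt|i ilt|i ilt|].
- by exists (udir (b i.*2.+1)); exists (b i.*2.+1) => //=; rewrite in_itv/= lexx ltW.
- apply: connected_continuous_connected; first exact: segment_connected.
  by apply: continuous_subspaceT; exact: continuous_udir.
- apply: closed_compact_plane; apply: continuous_compact; last exact: segment_compact.
  by apply: continuous_subspaceT; exact: continuous_udir.
- move=> i j /= ilt jlt [x [[s /= si <-] [t /= tj Est]]].
  rewrite !in_itv/= in si tj.
  have /andP[s0 s2] := break_arc ilt si; have /andP[t0 t2] := break_arc jlt tj.
  have st : s = t.
    by apply/esym/udir_inj => //; rewrite ltr_norml; apply/andP; split; lra.
  have [ij|ij|//] := ltngtP i j; exfalso.
    have : b i.*2.+2 < b j.*2.+1.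
      by apply: (lt_le_trans (b_lt _)); apply: (break_homo b_lt) => //; lia.
    lra.
  have : b j.*2.+2 < b i.*2.+1.
    by apply: (lt_le_trans (b_lt _)); apply: (break_homo b_lt) => //; lia.
  lra.
Qed.

Lemma one_arcs_cell k t : (k < n.*2)%N -> b k < t < b k.+1 ->
  \1_(arcs one_arcs) (udir t) = (odd k)%:R :> R.
Proof.
move=> klt tk; rewrite indicE; congr (_ %:R); congr nat_of_bool; apply/idP/idP.
  rewrite inE one_arcsE => -[i ilt [s /= si Est]]; rewrite in_itv/= in si.
  have /andP[s0 s2] := break_arc ilt si.
  have bk0 : 0 <= b k by rewrite -b0; apply: (break_homo b_lt).
  have bk2 : b k.+1 <= pi *+ 2 by rewrite -break_last; apply: (break_homo b_lt).
  have st : s = t.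
    by apply: udir_inj => //; rewrite ltr_norml; apply/andP; split; lra.
  have [ki|ki|->] := ltngtP k i.*2.+1; last by rewrite /= odd_double.
    by have : b k.+1 <= b i.*2.+1 by [apply: (break_homo b_lt)]; lra.
  by have : b i.*2.+2 <= b k by [apply: (break_homo b_lt)]; lra.
move=> kodd; rewrite inE one_arcsE; exists k./2; first by rewrite /=; lia.
exists t => //=; rewrite in_itv/=.
have := odd_double_half k; rewrite kodd add1n => ->.
by case/andP: tk => /ltW -> /ltW ->.
Qed.

End reuleaux_arcs.

(** * Curvature densities *)

Lemma integrable_disjU d (T : measurableType d) (R : realType)
    (mu : {measure set T -> \bar R}) (A B : set T) (f : T -> \bar R) :
  measurable A -> measurable B -> [disjoint A & B] ->
  mu.-integrable A f -> mu.-integrable B f -> mu.-integrable (A `|` B) f.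
Proof.
move=> mA mB AB /integrableP[fA iA] /integrableP[fB iB]; apply/integrableP.
split; first exact/measurable_funU.
rewrite ge0_integral_setU//; first exact: lte_add_pinfty.
by apply: measurableT_comp => //; exact/measurable_funU.
Qed.

Section piecewise_integral.
Variables (R : realType) (b : nat -> R).
Hypothesis b_lt : forall k, b k < b k.+1.
Notation mu := (@lebesgue_measure R).

(** [F] is prescribed only on the open cell because a density may jump at the breaks; the half-open
    interval lets cells be appended without overlap. *)
Lemma integrable_cell (F G : R -> R) (u v : R) : u < v -> continuous G ->
  (forall t, u < t < v -> F t = G t) ->
  mu.-integrable `]u, v] (EFin \o F) /\
  \int[mu]_(t in `]u, v]) F t = \int[mu]_(t in `[u, v]) G t.
Proof.
move=> uv cG FG.
have iG : mu.-integrable `[u, v] (EFin \o G).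
  apply: continuous_compact_integrable; first exact: segment_compact.
  exact: continuous_subspaceT.
have iGo : mu.-integrable `]u, v[ (EFin \o G).
  by apply: integrableS iG => //; apply: subset_itv; rewrite bnd_simp.
have iF : mu.-integrable `]u, v[ (EFin \o F).
  apply: eq_integrable iGo => // t; rewrite inE/= in_itv/= => tuv.
  by rewrite /= FG.
have iF1 : mu.-integrable `]u, v] (EFin \o F).
  rewrite -(@setUitv1 _ _ _ _ true) ?bnd_simp//; apply: integrable_disjU => //.
    apply/disj_set2P; rewrite -subset0 => t /= [tv Et].
    by move: tv; rewrite Et in_itv/= ltxx andbF.
  apply/integrableP; split; first exact: measurable_fun_set1.
  by rewrite integral_set1.
split => //.
rewrite -Rintegral_itv_bndo_bndc// -[RHS]Rintegral_itv_bndo_bndc; last first.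
  by apply: integrableS iG => //; apply: subset_itv; rewrite bnd_simp.
rewrite -[RHS]Rintegral_itv_obnd_cbnd//.
by apply: eq_Rintegral => t; rewrite inE/= in_itv/=; exact: FG.
Qed.

Lemma piecewise_integral (F : R -> R) (G : nat -> R -> R) m :
  (forall k, continuous (G k)) ->
  (forall k t, (k < m)%N -> b k < t < b k.+1 -> F t = G k t) ->
  mu.-integrable `[b 0, b m] (EFin \o F) /\
  \int[mu]_(t in `[b 0, b m]) F t =
    \sum_(k < m) \int[mu]_(t in `[b k, b k.+1]) G k t.
Proof.
move=> cG; elim: m => [|m IH] FG.
  rewrite set_itv1 Rintegral_set1 big_ord0; split => //.
  apply/integrableP; split; first exact: measurable_fun_set1.
  by rewrite integral_set1.
have [|iF EF] := IH; first by move=> k t km; apply: FG; exact: ltnW.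
have [iC EC] := integrable_cell (b_lt m) (cG m) (fun t => @FG m t (ltnSn m)).
have b0m : b 0 <= b m by exact: break_homo.
have -> : `[b 0, b m.+1]%classic = `[b 0, b m]%classic `|` `]b m, b m.+1]%classic.
  by rewrite (@itv_bndbnd_setU _ _ _ (BRight (b m))) ?bnd_simp// ltW.
have dis : [disjoint `[b 0, b m]%classic & `]b m, b m.+1]%classic].
  apply/disj_set2P; rewrite -subset0 => t /= [t1 t2].
  by move: t1 t2; rewrite !in_itv/= => /andP[_ tm] /andP[]; rewrite ltNge tm.
have iU : mu.-integrable (`[b 0, b m] `|` `]b m, b m.+1]) (EFin \o F).
  exact: integrable_disjU.
by split => //; rewrite Rintegral_setU// big_ord_recr/= EF EC.
Qed.

End piecewise_integral.

Lemma derive1_periodic (R : realType) (f : R -> R) (T : R) :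
  periodic f T -> periodic (derive1 (f : R -> R^o)) T.
Proof.
move=> fT t; rewrite /derive1 fT.
under [X in X @ _]funext => h do rewrite addrA fT.
by [].
Qed.

Lemma smooth_derive (R : realType) (phi : R -> R) (k : nat) (t : R) : smooth phi ->
  is_derive t 1 (derive1n k (phi : R -> R^o) : R -> R^o)
    (derive1n k.+1 (phi : R -> R^o) t).
Proof.
move=> sphi; rewrite derive1nS derive1E; by apply: derivableP; exact: sphi.
Qed.

Lemma is_derive_continuous (R : realType) (f f' : R -> R) :
  (forall t : R, is_derive t 1 (f : R -> R^o) (f' t)) -> continuous f.
Proof.
move=> ff' t; have df : derivable (f : R -> R^o) t 1 by have [] := ff' t.
have cf : {for t, continuous (f : R -> R^o)}.
  by apply: differentiable_continuous; apply/derivable1_diffP.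
exact: cf.
Qed.

Lemma Rintegral_is_derive (R : realType) (f F : R -> R) (u v : R) : u < v ->
  continuous f -> (forall t : R, is_derive t 1 (F : R -> R^o) (f t)) ->
  \int[@lebesgue_measure R]_(t in `[u, v]) f t = F v - F u.
Proof.
move=> uv cf dF; have cF := is_derive_continuous dF.
rewrite /Rintegral (@continuous_FTC2 _ f F u v uv) //.
- exact: continuous_subspaceT.
- split => [t _||]; first by have [] := dF t.
  + by apply: cvg_at_right_filter; exact: cF.
  + by apply: cvg_at_left_filter; exact: cF.
- by move=> t _; rewrite derive1E; have [_ ->] := dF t.
Qed.

Section density.
Variables (R : realType) (n : nat) (b : nat -> R) (q : nat -> plane R).
Hypotheses (n_odd : odd n) (b0 : b 0 = 0) (b_lt : forall k, b k < b k.+1).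
Hypothesis b_per : forall k, b (k + n) = b k + pi.
Hypothesis q_step : forall k, q k.+1 = q k + (-1) ^+ k.+1 *: udir (b k.+1).
Hypothesis q_per0 : q n = q 0.
Notation mu := (@lebesgue_measure R).

Lemma is_rho_reuleaux : is_rho (reuleaux b q) (fun t => \1_(arcs (one_arcs n b)) (udir t)).
Proof.
have b2pi := break_last b0 b_per.
have onecell k t : (k < n.*2)%N -> b k < t < b k.+1 ->
    \1_(arcs (one_arcs n b)) (udir t) = (odd k)%:R :> R.
  exact: one_arcs_cell.
split.
- by move=> t; rewrite udirD2pi.
- rewrite -b2pi -{1}b0.
  apply: (piecewise_integral b_lt (G := fun k _ => (odd k)%:R) _ onecell).1.
  by move=> k; exact: cst_continuous.
move=> phi sphi phiT.
pose phi1 := derive1n 1 (phi : R -> R^o) : R -> R.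
pose phi2 := derive1n 2 (phi : R -> R^o) : R -> R.
have d0 (t : R) : is_derive t 1 (phi : R -> R^o) (phi1 t) := smooth_derive 0 t sphi.
have d1 (t : R) : is_derive t 1 (phi1 : R -> R^o) (phi2 t) := smooth_derive 1 t sphi.
have c0 := is_derive_continuous d0; have c1 := is_derive_continuous d1.
have c2 : continuous phi2 := is_derive_continuous (fun t => smooth_derive 2 t sphi).
have phi1T : periodic phi1 (pi *+ 2) by exact: derive1_periodic.
(* On cell [k], [h k] is the support function and [h1 k] its derivative. *)
pose h k t : R := (q k).1 * cos t + (q k).2 * sin t + (odd k)%:R.
pose h1 k t : R := (q k).2 * cos t - (q k).1 * sin t.
have ch k : continuous (h k).
  move=> t; apply: cvgD; last exact: cvg_cst.
  by apply: cvgD; apply: cvgM; [exact: cvg_cst|exact: continuous_cos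
    |exact: cvg_cst|exact: continuous_sin].
(* Since [h k] plus its second derivative is the constant [(odd k)%:R], the difference of the two
   integrands is an exact derivative. *)
have dF k (t : R) : is_derive t 1 ((fun t => h k t * phi1 t - h1 k t * phi t) : R -> R^o)
    (h k t * (phi t + phi2 t) - (odd k)%:R * phi t).
  rewrite /h /h1.
  apply: is_derive_eq.
  rewrite /GRing.scale/=; ring.
have cG k : continuous (fun t => h k t * (phi t + phi2 t)).
  by move=> t; apply: cvgM; [exact: ch|apply: cvgD; [exact: c0|exact: c2]].
have ce k : continuous (fun t => (odd k)%:R * phi t : R).
  by move=> t; apply: cvgM; [exact: cvg_cst|exact: c0].
have int_cont (f : R -> R) u v : continuous f -> mu.-integrable `[u, v] (EFin \o f).
  move=> cf; apply: continuous_compact_integrable; first exact: segment_compact.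
  exact: continuous_subspaceT.
have E1 : \int[mu]_(t in `[b 0, b n.*2]) (support_fun (reuleaux b q) t * (phi t + phi2 t)) =
    \sum_(k < n.*2) \int[mu]_(t in `[b k, b k.+1]) (h k t * (phi t + phi2 t)).
  apply: (piecewise_integral b_lt (G := fun k t => h k t * (phi t + phi2 t)) cG _).2.
  move=> k t _ /andP[/ltW tk1 /ltW tk2].
  by rewrite (support_reuleaux n_odd b_lt b_per q_step q_per0 (k := k)) ?tk1.
have E2 : \int[mu]_(t in `[b 0, b n.*2]) (\1_(arcs (one_arcs n b)) (udir t) * phi t) =
    \sum_(k < n.*2) \int[mu]_(t in `[b k, b k.+1]) ((odd k)%:R * phi t).
  apply: (piecewise_integral b_lt (G := fun k t => (odd k)%:R * phi t) ce _).2.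
  by move=> k t kn tk; rewrite (onecell k t).
rewrite (_ : `[0, pi *+ 2]%classic = `[b 0, b n.*2]%classic); last by rewrite b0 b2pi.
rewrite E1 E2; apply/eqP; rewrite -subr_eq0 -sumrB; apply/eqP.
pose W k := h k (b k) * phi1 (b k) - h1 k (b k) * phi (b k).
transitivity (\sum_(0 <= k < n.*2) (W k.+1 - W k)).
  rewrite big_mkord; apply: eq_bigr => k _.
  rewrite -RintegralB//; [|exact: int_cont..].
  rewrite (Rintegral_is_derive (b_lt k) _ (dF k)); last first.
    by move=> t; apply: cvgB; [exact: cG|exact: ce].
  (* Consecutive [q] differ by plus or minus [udir (b k.+1)], so value and derivative of the support
     function agree from both sides of the break. The boundary terms therefore telescope. *)
  congr (_ - _); rewrite /W /h /h1 q_step /= /GRing.scale/=.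
  have := cos2sin2 (b k.+1); rewrite -signr_odd /=.
  by case: (odd k) => /= cs; rewrite ?expr1 ?expr0; ring: cs.
(* The two remaining terms, at [0] and [pi *+ 2], cancel by periodicity. *)
rewrite (telescope_sumr W)// /W b2pi b0 /h /h1 -addnn.
rewrite (center_periodic n_odd b_per q_step q_per0) q_per0 addnn odd_double.
rewrite cos2pi sin2pi cos0 sin0 -[in LHS](add0r (pi *+ 2)) phiT phi1T subrr//.
Qed.

End density.

Section reuleaux_membership.
Variables (R : realType) (n : nat) (b : nat -> R) (q : nat -> plane R).
Hypotheses (n_odd : odd n) (b0 : b 0 = 0) (b_lt : forall k, b k < b k.+1).
Hypothesis b_per : forall k, b (k + n) = b k + pi.
Hypothesis q_step : forall k, q k.+1 = q k + (-1) ^+ k.+1 *: udir (b k.+1).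
Hypothesis q_per0 : q n = q 0.

Lemma Rn_reuleaux : (reuleaux b q)° !=set0 -> Rn n (reuleaux b q).
Proof.
move=> K0; split; first exact: (@W1_reuleaux R n).
exists (fun t => \1_(arcs (one_arcs n b)) (udir t)), (one_arcs n b); split.
- exact: is_rho_reuleaux.
- by move=> ab; apply: one_arcs_lt.
- exact: aeW.
- exact: one_arcs_components.
Qed.

End reuleaux_membership.

(** * Discrete completion to constant width *)

Section completion.
Variables (R : realType) (N : nat) (c : R) (g : nat -> R).
Hypotheses (N_gt0 : (0 < N)%N) (c_lt1 : c < 1).
Hypothesis g_per : forall i, g (i + N + N) = g i.
Hypothesis g_convex : forall i, c *+ 2 * g i.+1 <= g i + g i.+2.
Hypothesis g_width : forall i, 0 <= g i + g (i + N) <= 1.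

(** Periodic sequences are coded as row vectors to have compactness in finite dimension. The default
    [0] is never reached, as [N > 0]. *)
Definition vec_fun (v : 'rV[R]_(N + N)) (i : nat) : R :=
  match insub (i %% (N + N))%N with Some j => v ord0 j | None => 0 end.

Lemma vec_fun_ord (v : 'rV[R]_(N + N)) (j : 'I_(N + N)) : vec_fun v j = v ord0 j.
Proof.
rewrite /vec_fun modn_small//.
by case: insubP => [i _ /val_inj ->|]//; rewrite ltn_ord.
Qed.

Lemma vec_fun_per v i : vec_fun v (i + N + N) = vec_fun v i.
Proof. by rewrite /vec_fun -addnA modnDr. Qed.

Lemma vec_funE (f : nat -> R) i : (forall i, f (i + N + N)%N = f i) ->
  vec_fun (\row_j f j) i = f i.
Proof.
move=> f_per; rewrite /vec_fun; case: insubP => [j _ jE|]; last first.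
  by rewrite ltn_mod addn_gt0 N_gt0.
rewrite mxE jE [in RHS](divn_eq i (N + N)) addnC.
by elim: (_ %/ _)%N => [|m IH]; rewrite ?addn0// mulSn [(_ + _ * _)%N]addnC !addnA f_per.
Qed.

Lemma vec_fun_continuous i : continuous (fun v => vec_fun v i).
Proof.
move=> v; rewrite /vec_fun; case: insubP => [j _ _|_]; last exact: (@cst_continuous _ _ (0 : R)).
exact: coord_continuous.
Qed.

Definition feasible : set 'rV[R]_(N + N) :=
  [set v | forall i, [/\ g i <= vec_fun v i,
    c *+ 2 * vec_fun v i.+1 <= vec_fun v i + vec_fun v i.+2 &
    vec_fun v i + vec_fun v (i + N) <= 1]].

Lemma feasible_compact : compact feasible.
Proof.
(* The upper end of each interval comes from the width bound together with
   [g (j + N) <= vec_fun v (j + N)]. *)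
have box := rV_compact (fun j : 'I_(N + N) => @segment_compact R (g j) (1 - g (j + N)%N)).
apply: subclosed_compact box _.
- have cle (f h : 'rV[R]_(N + N) -> R) : continuous f -> continuous h ->
      closed [set v | f v <= h v].
    move=> cf ch.
    have -> : [set v | f v <= h v] = (fun v => f v - h v) @^-1` [set r | r <= 0].
      by apply/seteqP; split => v /=; rewrite subr_le0.
    apply: closed_comp; last exact: closed_le.
    by move=> v _; exact: (cvgB (cf v) (ch v)).
  have cv i := @vec_fun_continuous i.
  have -> : feasible = \bigcap_(i in [set: nat]) ([set v | g i <= vec_fun v i] `&`
     ([set v | c *+ 2 * vec_fun v i.+1 <= vec_fun v i + vec_fun v i.+2] `&`
      [set v | vec_fun v i + vec_fun v (i + N) <= 1])).
    apply/seteqP; split => [v fv i _|v fv i]; first by have [] := fv i.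
    by have [//|? []] := fv i.
  apply: closed_bigI => i _; apply: closedI; last apply: closedI.
  + by apply: cle => //; exact: cst_continuous.
  + apply: cle => v; last exact: (cvgD (cv i v) (cv i.+2 v)).
    exact: (cvgM (cvg_cst (c *+ 2)) (cv i.+1 v)).
  + by apply: cle => v; [exact: (cvgD (cv i v) (cv (i + N)%N v))|exact: cst_continuous].
- move=> v fv j /=; rewrite in_itv/= -vec_fun_ord.
  have [-> _ w] := fv j; have [gN _ _] := fv (j + N)%N; rewrite /=; lra.
Qed.

Lemma vec_fun_mod v i j : i = j %[mod N + N] -> vec_fun v i = vec_fun v j.
Proof. by rewrite /vec_fun => ->. Qed.

(** A maximizer of the sum of all entries is in particular maximal for the pointwise order, which is
    what the completion needs. *)
Lemma feasible_max : exists2 v, feasible v &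
  forall f : nat -> R, (forall i, f (i + N + N)%N = f i) -> (forall i, [/\ g i <= f i,
    c *+ 2 * f i.+1 <= f i + f i.+2 & f i + f (i + N)%N <= 1]) ->
  \sum_(j < N + N) f j <= \sum_(j < N + N) vec_fun v j.
Proof.
have in_feasible (f : nat -> R) : (forall i, f (i + N + N)%N = f i) ->
    (forall i, [/\ g i <= f i, c *+ 2 * f i.+1 <= f i + f i.+2 &
      f i + f (i + N)%N <= 1]) -> feasible (\row_j f j).
  by move=> f_per ff i; rewrite !vec_funE.
have feasible0 : feasible !=set0.
  exists (\row_j g j); apply: in_feasible => // i.
  by have /andP[_ ?] := g_width i.
have [|v] := @EVT_max_rV R _ (fun v => \sum_(j < N + N) v ord0 j) _ feasible0 feasible_compact.
  apply: continuous_subspaceT; apply: continuous_big => [|j _ v].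
    exact: add_continuous.
  exact: coord_continuous.
rewrite inE => fv vmax; exists v => // f f_per ff.
under [leRHS]eq_bigr do rewrite vec_fun_ord.
rewrite (le_trans _ (vmax (\row_j f j) _)) ?inE//; last exact: in_feasible.
by apply: ler_sum => j _; rewrite mxE.
Qed.

Lemma discrete_completion : exists h : nat -> R,
  [/\ forall i, h (i + N + N)%N = h i, forall i, g i <= h i,
    forall i, c *+ 2 * h i.+1 <= h i + h i.+2 & forall i, h i + h (i + N)%N = 1].
Proof.
have [v fv vmax] := feasible_max.
set h := vec_fun v in vmax; have h_per : forall i, h (i + N + N)%N = h i := vec_fun_per v.
have h_mod : forall i j, i = j %[mod N + N] -> h i = h j := vec_fun_mod v.
have hg i : g i <= h i by have [] := fv i.
have hc i : c *+ 2 * h i.+1 <= h i + h i.+2 by have [] := fv i.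
have hw i : h i + h (i + N)%N <= 1 by have [] := fv i.
exists h; split => //.
pose w i := h i + h (i + N)%N.
have wN i : w (i + N)%N = w i by rewrite /w h_per addrC.
have w_ge0 i : 0 <= w i.
  by have /andP[+ _] := g_width i; have := hg i; have := hg (i + N)%N; rewrite /w; lra.
have w_mod i j : i = j %[mod N + N] -> w i = w j.
  move=> ij; rewrite /w (h_mod i j ij); congr (_ + _); apply: h_mod.
  by rewrite -modnDml ij modnDml.
(* If the convexity inequality at [i.+1] were strict, a small increase of [h i.+1] would stay
   feasible, against maximality. *)
have tight i : w i.+1 < 1 -> c *+ 2 * h i.+1 = h i + h i.+2.
  move=> w1; apply/eqP; rewrite eq_le hc /= leNgt; apply/negP => slack.
  (* The increase adds at most [eta] to a width and, as [c < 1], at most [eta *+ 2] to the left side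
     of the convexity inequality; the two bounds in the minimum absorb this. At the neighbouring
     indices convexity only improves. *)
  pose eta := Num.min (1 - w i.+1) ((h i + h i.+2 - c *+ 2 * h i.+1) / 2).
  have eta0 : 0 < eta by rewrite lt_min; lra.
  have eta1 : eta <= 1 - w i.+1 by rewrite ge_min lexx.
  have eta2 : eta <= (h i + h i.+2 - c *+ 2 * h i.+1) / 2 by rewrite ge_min lexx orbT.
  pose d k : R := (k == i.+1 %[mod N + N])%:R.
  have d0 k : 0 <= d k by [].
  have per k : h (k + N + N)%N + eta * d (k + N + N)%N = h k + eta * d k.
    by rewrite h_per /d -addnA modnDr.
  have N2 : (0 < N + N)%N by rewrite addn_gt0 N_gt0.
  have dpos : 0 < \sum_(j < N + N) eta * d j.
    rewrite (bigD1 (Ordinal (ltn_pmod i.+1 N2)))//= /d modn_mod eqxx mulr1.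
    by rewrite ltr_pwDl// sumr_ge0// => j _; rewrite mulr_ge0// ltW.
  suff H : forall k, [/\ g k <= h k + eta * d k,
      c *+ 2 * (h k.+1 + eta * d k.+1) <= (h k + eta * d k) + (h k.+2 + eta * d k.+2) &
      (h k + eta * d k) + (h (k + N)%N + eta * d (k + N)%N) <= 1].
    have := vmax (fun k => h k + eta * d k) per H.
    by rewrite big_split /=; lra.
  move=> k; split.
  - by have := hg k; have : 0 <= eta * d k by [rewrite mulr_ge0// ltW]; lra.
  - have e0 : 0 <= eta * d k by rewrite mulr_ge0// ltW.
    have e2 : 0 <= eta * d k.+2 by rewrite mulr_ge0// ltW.
    rewrite {1}/d; case: eqP => [kE|_]; last by have := hc k; rewrite mulr0 addr0; lra.
    have k0 : k = i %[mod N + N] by apply/eqP; rewrite -(eqn_modDr 1) !addn1; apply/eqP.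
    have k2 : k.+2 = i.+2 %[mod N + N].
      by apply/eqP; rewrite -addn1 -[i.+2]addn1 eqn_modDr; apply/eqP.
    rewrite (h_mod _ _ k0) (h_mod _ _ kE) (h_mod _ _ k2) mulr1.
    have ceta : c * eta <= eta by rewrite ler_piMl ?ltW.
    by move: eta2 e0 e2 eta0 ceta; lra.
  - rewrite {1}/d; case: eqP => [kE|_].
      (* [k] and [k + N] differ modulo [N + N], so the increase enters each width only once. *)
      have -> : d (k + N)%N = 0.
        rewrite /d; case: eqP => // kN; exfalso.
        have : N + k == 0 + k %[mod N + N].
          by rewrite addnC kN add0n kE.
        rewrite eqn_modDr mod0n modn_small; last by rewrite -[ltnLHS]addn0 ltn_add2l.
        by move=> /eqP N0; move: N_gt0; rewrite N0.
      by have := w_mod _ _ kE; rewrite {1}/w mulr1 mulr0; lra.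
    rewrite mulr0 addr0 /d; case: eqP => [kE|_]; last by rewrite mulr0 addr0.
    by have := w_mod _ _ kE; rewrite wN {1}/w mulr1; lra.
(* Equality holds at [i] and at [i + N], whose widths coincide; the two equations are added. *)
have wtight i : w i.+1 < 1 -> c *+ 2 * w i.+1 = w i + w i.+2.
  move=> w1; have t1 := tight i w1.
  have t2 : c *+ 2 * h (i.+1 + N)%N = h (i + N)%N + h (i.+2 + N)%N.
    have w1N : w (i.+1 + N)%N < 1 by rewrite wN.
    exact: (tight (i + N)%N).
  by rewrite /w mulrDr t1 t2; ring.
have N2 : (0 < N + N)%N by rewrite addn_gt0 N_gt0.
have [i0 i0min] : exists i0, forall i, w i0.+1 <= w i.
  have [j _ jmin] := @arg_minP _ R _ (Ordinal N2) xpredT (fun j : 'I_(N + N) => w j) isT.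
  (* One less than a full period is added so that the successor is congruent to the minimizing index
     [j]. *)
  exists (j + (N + N).-1)%N => i; rewrite -addnS prednK//.
  rewrite (w_mod _ j); last by rewrite modnDr.
  rewrite (w_mod i (i %% (N + N))%N); last by rewrite modn_mod.
  exact: (jmin (Ordinal (ltn_pmod i N2))).
have [w1|w1] := ltP (w i0.+1) 1; last first.
  by move=> i; apply/eqP; rewrite eq_le hw (le_trans w1 (i0min i)).
exfalso.
(* Minimality gives [w i0 + w i0.+2 >= 2 * w i0.+1], while tightness makes the left side
   [c *+ 2 * w i0.+1]; with [c < 1] and [w >= 0] this forces zero. *)
have w0 : w i0.+1 = 0.
  have := wtight _ w1; have := i0min i0; have := i0min i0.+2; have := w_ge0 i0.+1.
  by move: c_lt1; nra.
(* A zero width spreads forward: its two neighbours are nonnegative and, by tightness, sum to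
   zero. *)
have wall k : w (i0.+1 + k)%N = 0.
  elim: k => [|k IH]; first by rewrite addn0.
  have := wtight (i0 + k)%N; rewrite -!addSn IH mulr0 => /(_ ltr01).
  have := w_ge0 (i0 + k)%N; have := w_ge0 (i0.+2 + k)%N; rewrite -addSnnS; lra.
have wall0 k : w k = 0.
  rewrite (w_mod k (i0.+1 + (k + (i0.+1 * (N + N) - i0.+1)))%N) ?wall//.
  have le_i : (i0.+1 <= i0.+1 * (N + N))%N by rewrite leq_pmulr.
  by rewrite addnCA subnKC// addnC modnMDl.
(* With all widths zero, adding [1 / 2] to every entry makes all widths one and keeps convexity,
   which contradicts maximality. *)
have d0 : 0 < 2^-1 *+ (N + N) :> R by rewrite pmulrn_lgt0// invr_gt0.
suff H : forall i, [/\ g i <= h i + 2^-1,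
    c *+ 2 * (h i.+1 + 2^-1) <= (h i + 2^-1) + (h i.+2 + 2^-1) &
    (h i + 2^-1) + (h (i + N)%N + 2^-1) <= 1].
  have := vmax (fun k => h k + 2^-1) (fun i => congr1 (+%R ^~ 2^-1) (h_per i)) H.
  by rewrite big_split /= sumr_const card_ord; lra.
move=> i; have := hg i; have := hc i; have := wall0 i; rewrite /w => w0i hci hgi.
split; [lra| |lra].
by move: hci c_lt1; rewrite mulrDr; nra.
Qed.

End completion.

(** * From support numbers to Reuleaux polygons *)

Section break_sequence.
Variables (R : realType) (n : nat) (T : R) (base : nat -> R).
Hypotheses (n_gt0 : (0 < n)%N) (base0 : base 0 = 0).
Hypothesis base_lt : forall r, (r.+1 < n)%N -> base r < base r.+1.
Hypothesis base_last : base n.-1 < T.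

Definition break_ext (k : nat) : R := T *+ (k %/ n) + base (k %% n).

Lemma break_ext_small k : (k < n)%N -> break_ext k = base k.
Proof. by move=> kn; rewrite /break_ext divn_small// modn_small// add0r. Qed.

Lemma break_ext_per k : break_ext (k + n) = break_ext k + T.
Proof. by rewrite /break_ext modnDr divnDr ?dvdnn// divnn n_gt0 addn1 mulrSr addrAC. Qed.

(** Within a block this is [base_lt]; across blocks it is [base_last] together with [base 0 = 0]. *)
Lemma break_ext_lt k : break_ext k < break_ext k.+1.
Proof.
rewrite /break_ext modnS divnS//; case: ifPn => [dv|ndv].
  rewrite add1n mulrSr base0 addr0 ltrD2l.
  suff -> : (k %% n = n.-1)%N by [].
  have := ltn_pmod k n_gt0; move: dv; rewrite /dvdn -addn1 -modnDml addn1.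
  set r := (k %% n)%N; rewrite [(r < n)%N]leq_eqVlt => rn /predU1P[<-//|kn].
  by move: rn; rewrite modn_small.
rewrite add0n ltrD2l; apply: base_lt.
have := ltn_pmod k n_gt0; move: ndv; rewrite /dvdn -addn1 -modnDml addn1.
set r := (k %% n)%N; rewrite [(r < n)%N]leq_eqVlt => rn /predU1P[kn|//].
by move: rn; rewrite kn modnn.
Qed.
End break_sequence.

Section from_support_numbers.
Variables (R : realType) (N : nat) (H : nat -> R).
Let d : R := pi / N%:R.
Let half : R := d / 2.
(** The half-step offset puts the vertices of the circumscribed polygon at the angles [i * d], so
    that the half turn from [0] to [pi] runs from vertex to vertex. *)
Definition cell_center (i : nat) : R := i%:R * d - half.
Notation cen := cell_center.
Hypothesis N_gt1 : (1 < N)%N.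
Hypothesis H_width : forall i, H i + H (i + N) = 1.
Hypothesis H_convex : forall i, cos d *+ 2 * H i.+1 < H i + H i.+2.

Let n := N.*2.+1.

Let N_neq0 : N%:R != 0 :> R.
Proof. by rewrite pnatr_eq0; lia. Qed.

Let Nd : N%:R * d = pi.
Proof. by rewrite /d mulrC divfK. Qed.

Let d_gt0 : 0 < d.
Proof. by rewrite divr_gt0 ?pi_gt0// ltr0n; lia. Qed.

Let d_le : d <= pi / 2.
Proof.
rewrite /d ler_pM2l ?pi_gt0// lef_pV2 ?posrE ?ltr0n//; last by lia.
by rewrite ler_nat.
Qed.

Let dE : d = half + half.
Proof. by rewrite /half -splitr. Qed.

Let half_gt0 : 0 < half.
Proof. by rewrite divr_gt0. Qed.

Let half_le : half <= pi / 4.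
Proof. by move: d_le; rewrite dE; lra. Qed.

Let sin_half : 0 < sin half.
Proof. by apply: sin_gt0_pi; rewrite half_gt0 /=; have := half_le; have := pi_gt0 R; lra. Qed.

Let cos_half : 0 < cos half.
Proof.
by apply: cos_gt0_pihalf; have := half_gt0; have := half_le; have := pi_gt0 R; lra.
Qed.

Let cosdE : cos d = 1 - sin half ^+ 2 *+ 2.
Proof. by rewrite dE cosD -!expr2 cos2sin2; ring. Qed.

Let cenS i : cen i.+1 = cen i + d.
Proof. by rewrite /cell_center -natr1; ring. Qed.

(** The edge with normal angle [cen i.+1] of the circumscribed polygon has length
    [2 tan(half) * rho i]. *)
Let rho (i : nat) : R := (H i + H i.+2 - cos d *+ 2 * H i.+1) / (2 - cos d *+ 2).

Let den_gt0 : 0 < 2 - cos d *+ 2.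
Proof. by rewrite cosdE; have := exprn_gt0 2 sin_half; lra. Qed.

Let rho_gt0 i : 0 < rho i.
Proof. by rewrite divr_gt0// subr_gt0. Qed.

Let rhoD i : rho i + rho (i + N) = 1.
Proof.
rewrite /rho -mulrDl.
have -> : H i + H i.+2 - cos d *+ 2 * H i.+1 +
    (H (i + N) + H (i + N).+2 - cos d *+ 2 * H (i + N).+1) = 2 - cos d *+ 2.
  have := H_width i; have := H_width i.+1; have := H_width i.+2; rewrite !addSn.
  move=> e2 e1 e0.
  have -> : H (i + N) = 1 - H i by rewrite -e0; ring.
  have -> : H (i + N).+1 = 1 - H i.+1 by rewrite -e1; ring.
  have -> : H (i + N).+2 = 1 - H i.+2 by rewrite -e2; ring.
  ring.
by rewrite divff// gt_eqF.
Qed.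

Let rho_lt1 i : rho i < 1.
Proof. by rewrite -(rhoD i) ltrDl. Qed.

(** Half the opening of a unit arc whose chord, [2 sin(half) * rho i], is that edge scaled by
    [cos half]. *)
Let ell i := asin (sin half * rho i).

Let sin_ell i : sin (ell i) = sin half * rho i.
Proof.
rewrite asinK// in_itv/=; have := rho_gt0 i; have := rho_lt1 i.
by have := sin_half; have := sin_le1 half; nra.
Qed.

Let ell_bound i : 0 < ell i < half.
Proof.
have arg : -1 < sin half * rho i < 1.
  have := rho_gt0 i; have := rho_lt1 i.
  by have := sin_half; have := sin_le1 half; nra.
have pi0 := pi_gt0 R.
have ell_in : ell i \in `[(- (pi/2)), (pi/2)].
  case/andP: arg => a1 a2.
  by rewrite in_itv/= asin_geNpi2 ?asin_lepi2// ?ltW// ?(ltW a1) ?(ltW a2).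
apply/andP; split.
  rewrite -(ltr_sin _ ell_in) ?in_itv/=; last by lra.
  by rewrite sin0 sin_ell mulr_gt0.
rewrite -(ltr_sin ell_in) ?in_itv/=; last by have := half_le; have := half_gt0; lra.
by rewrite sin_ell gtr_pMr.
Qed.

(** In the first half turn the arc for edge [i] has normal angles within [ell i] of [cen i.+1]. The
    additional break at [0] makes the number of cells per half turn odd. *)
Let base (k : nat) : R := if k == 0%N then 0 else
  cen k.-1./2.+1 + (if odd k then - ell k.-1./2 else ell k.-1./2).

Let base_odd i : base i.*2.+1 = cen i.+1 - ell i.
Proof. by rewrite /base /= odd_double doubleK. Qed.

Let base_even i : base i.*2.+2 = cen i.+1 + ell i.
Proof. by rewrite /base /= odd_double uphalf_double. Qed.

Let n_gt0 : (0 < n)%N. Proof. by []. Qed.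

Let base_lt r : (r.+1 < n)%N -> base r < base r.+1.
Proof.
move=> _; case: r => [|r].
  rewrite (base_odd 0) /base /= /cell_center mul1r.
  by have := ell_bound 0; rewrite dE; lra.
rewrite -[r]odd_double_half; case: (odd r); rewrite ?add1n ?add0n.
  rewrite -doubleS base_even base_odd [cen _.+2]cenS.
  by have := ell_bound r./2; have := ell_bound r./2.+1; rewrite dE; lra.
by rewrite base_even base_odd; have := ell_bound r./2; lra.
Qed.

Let base_last : base n.-1 < pi.
Proof.
have -> : n.-1 = N.-1.*2.+2 by rewrite /n; lia.
rewrite base_even prednK; last by lia.
by rewrite /cell_center Nd; have := ell_bound N.-1; lra.
Qed.

Let b := break_ext n pi base.

Let b_odd i : (i < N)%N -> b i.*2.+1 = cen i.+1 - ell i.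
Proof. by move=> iN; rewrite /b break_ext_small ?base_odd// /n; lia. Qed.

Let b_even i : (i < N)%N -> b i.*2.+2 = cen i.+1 + ell i.
Proof. by move=> iN; rewrite /b break_ext_small ?base_even// /n; lia. Qed.

Let b0 : b 0 = 0. Proof. by rewrite /b break_ext_small. Qed.

Let b_lt k : b k < b k.+1.
Proof. exact: break_ext_lt. Qed.

Let b_per k : b (k + n) = b k + pi.
Proof. exact: break_ext_per. Qed.

(* The vertex of the circumscribed polygon at the angle [i * d], where the edges
   with normal angles [cen i] and [cen i.+1] meet, scaled by [cos half]. *)
Let p (i : nat) : plane R :=
  let x := (H i.+1 + H i) / 2 in let y := cos half / sin half * (H i.+1 - H i) / 2 in
  (x * cos (i%:R * d) - y * sin (i%:R * d), x * sin (i%:R * d) + y * cos (i%:R * d)).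

Fixpoint vertex_seq (k : nat) : plane R :=
  if k is k'.+1 then vertex_seq k' + (-1) ^+ k'.+1 *: udir (b k'.+1) else p 0.
Let q := vertex_seq.

Let pE i t : dotp (p i) (udir t) = (H i.+1 + H i) / 2 * cos (i%:R * d - t)
  - cos half / sin half * (H i.+1 - H i) / 2 * sin (i%:R * d - t).
Proof. by rewrite /dotp /= cosB sinB; ring. Qed.

Let p_left i : dotp (p i) (udir (cen i)) = cos half * H i.
Proof.
rewrite pE /cell_center opprB addrCA subrr addr0.
by field; rewrite gt_eqF.
Qed.

Let p_right i : dotp (p i) (udir (cen i.+1)) = cos half * H i.+1.
Proof.
rewrite pE cenS /cell_center.
have -> : i%:R * d - (i%:R * d - half + d) = - half by have := dE; lra.
by rewrite cosN sinN; field; rewrite gt_eqF.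
Qed.

Let udir_sub (t s : R) : udir (t + s) - udir (t - s) = (sin s *+ 2) *: udir (t + pi / 2).
Proof.
rewrite /udir cosDpihalf sinDpihalf cosD cosB sinD sinB.
by congr (_, _); rewrite /= /GRing.scale/=; ring.
Qed.

(** An edge of the scaled polygon is the chord of its arc. Hence two steps of [q], from a vertex to
    the centre and on to the other end of the arc, lead from [p i] to [p i.+1]. *)
Let pS i : p i.+1 = p i - udir (cen i.+1 - ell i) + udir (cen i.+1 + ell i).
Proof.
rewrite -addrA [- _ + _]addrC udir_sub sin_ell.
have e1 : (i.+1)%:R * d = cen i.+1 + half by rewrite /cell_center; ring.
have e0 : i%:R * d = cen i.+1 - half.
  by rewrite cenS /cell_center; have := dE; lra.
rewrite /p e1 e0 /rho cosdE /udir cosDpihalf sinDpihalf.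
have := sin_half; move: (cen i.+1) => C; rewrite !cosD !sinD cosN sinN.
have := cos2sin2 half; move: (cos half) (sin half) => c s cs s0.
move: (cos C) (sin C) (H i) (H i.+1) (H i.+2) => cC sC H0 H1 H2.
have nz : (2 - (1 - s ^+ 2 * 2) * 2 != 0) && (s != 0).
  have s2 := exprn_gt0 2 s0; have den0 : 0 < 2 - (1 - s ^+ 2 * 2) * 2 by lra.
  by rewrite !gt_eqF.
by congr (_, _); rewrite /= /GRing.scale/=; field: cs.
Qed.

(** Because opposite support numbers sum to one, scaling by [cos half] puts opposite vertices at
    distance exactly one; this is what closes up [q] after a half turn. *)
Let pN i : p (i + N)%N = p i - udir (i%:R * d).
Proof.
have HN j : H (j + N) = 1 - H j by rewrite -(H_width j); ring.
have angle : (i + N)%:R * d = i%:R * d + pi by rewrite natrD mulrDl Nd.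
rewrite /p /udir angle -addSn !HN cosDpi sinDpi.
by congr (_, _); rewrite /=; field; rewrite gt_eqF.
Qed.

Let q_even i : (i <= N)%N -> q i.*2 = p i.
Proof.
elim: i => [//|i IH] iN; rewrite doubleS /q /= -/q.
rewrite -/(q i.*2) IH ?(ltnW iN)// b_odd// b_even// pS.
rewrite -signr_odd -[in X in _ + X]signr_odd /= odd_double /= expr1 expr0.
by rewrite scaleN1r scale1r.
Qed.

Let b_n : b n = pi. Proof. by rewrite -[n]add0n b_per b0 add0r. Qed.

Let q_step k : q k.+1 = q k + (-1) ^+ k.+1 *: udir (b k.+1).
Proof. by []. Qed.

Let q_per0 : q n = q 0.
Proof.
rewrite q_step q_even// -/n b_n -signr_odd /= odd_double expr1 scaleN1r.
have := pN 0; rewrite add0n mul0r => ->.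
by rewrite -[in udir pi](add0r pi) udirDpi opprK subrK.
Qed.

Let n_odd : odd n. Proof. by rewrite /n /= odd_double. Qed.

(** In the first half turn [p r] is the vertex [q r.*2]. Each further half turn passes to the
    opposite cell, where vertex and arc exchange roles, and [pN] matches the change. *)
Let p_boundary i : exists j, b j <= i%:R * d <= b j.+1 /\
  p i = boundary_point q j (i%:R * d).
Proof.
rewrite (divn_eq i N) addnC; elim: (i %/ N)%N => [|m [j [jb jE]]].
  rewrite mul0n addn0; move: (ltnW (ltn_pmod i (ltnW N_gt1))).
  move: (i %% N)%N => r rN; exists r.*2; split; last first.
    by rewrite /boundary_point odd_double scale0r addr0 q_even.
  have rd : r%:R * d = cen r + half by rewrite /cell_center subrK.
  apply/andP; split.
    case: r rN rd => [|r] rN rd; first by rewrite b0 mul0r.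
    by rewrite doubleS b_even// rd; have := ell_bound r; lra.
  move: rN; rewrite leq_eqVlt => /predU1P[->|rN]; first by rewrite Nd b_n.
  by rewrite b_odd// rd cenS dE; have := ell_bound r; lra.
rewrite mulSnr addnA; set r := (i %% N + m * N)%N in jb jE *.
have angle : (r + N)%:R * d = r%:R * d + pi by rewrite natrD mulrDl Nd.
rewrite angle; exists (j + n)%N; split; first by rewrite -addSn !b_per !lerD2r.
rewrite pN jE /boundary_point (center_periodic n_odd b_per q_step q_per0).
rewrite odd_flip// udirDpi -addrA; congr (_ + _).
by case: (odd j); rewrite /= ?scale1r ?scale0r ?subrr ?add0r ?addrN.
Qed.

Lemma reuleaux_of_support_numbers : exists b q,
  [/\ b 0%N = 0, forall k, b k < b k.+1, forall k, b (k + N.*2.+1)%N = b k + pi,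
    forall k, q k.+1 = q k + (-1) ^+ k.+1 *: udir (b k.+1) & q N.*2.+1 = q 0%N] /\
    (forall y, (forall i, dotp y (udir (cell_center i)) <= H i) ->
      reuleaux b q (cos half *: y)).
Proof.
exists b, q; split => // y yH k t tk.
have [i /andP[ci ti]] : exists i, cen i <= t <= cen i.+1.
  have t0 : 0 <= t.
    by case/andP: tk => + _; apply: le_trans; rewrite -b0; apply: (break_homo b_lt).
  (* [m] half turns take [m * N] steps, and one more step makes up for the offset of [cen]. *)
  have [m tm] := archi_pi t; apply: (@seq_cover _ _ _ (m * N).+1).
  - by move=> j; rewrite cenS lerDl ltW.
  - by rewrite /cell_center mul0r; have := half_gt0; lra.
  - rewrite cenS /cell_center natrM -mulrA Nd mulrC mulr_natr.
    by have := half_gt0; rewrite dE; lra.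
have [j [jb pj]] := p_boundary i.
(* As [p i] lies in the Reuleaux polygon, it suffices to bound the height of the scaled [y] in
   direction [udir t] by that of [p i]. *)
have := boundary_in_reuleaux n_odd b_lt b_per q_step q_per0 jb tk.
rewrite -pj; apply: le_trans.
have sd : 0 < sin d.
  by apply: sin_gt0_pi; rewrite d_gt0 /=; have := d_le; have := pi_gt0 R; lra.
(* Nonnegative coefficients that express [udir t] through the two neighbouring normals; [p i]
   attains both scaled constraints, so the bounds on [y] combine. *)
pose al := sin (cen i.+1 - t) / sin d; pose be := sin (t - cen i) / sin d.
have al0 : 0 <= al.
  rewrite divr_ge0 ?(ltW sd)//; apply: sin_ge0_pi; rewrite subr_ge0 ti /=.
  by move: ci ti; rewrite cenS; have := d_le; have := pi_gt0 R; lra.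
have be0 : 0 <= be.
  rewrite divr_ge0 ?(ltW sd)//; apply: sin_ge0_pi; rewrite subr_ge0 ci /=.
  by move: ci ti; rewrite cenS; have := d_le; have := pi_gt0 R; lra.
have ut (z : plane R) : dotp z (udir t) =
    al * dotp z (udir (cen i)) + be * dotp z (udir (cen i.+1)).
  have := cos2sin2 (cen i); have := cos2sin2 d; move: sd.
  rewrite /al /be cenS /dotp /udir /=; move: (cen i) => C.
  rewrite !sinB !cosD !sinD.
  move: (cos C) (sin C) (cos d) (sin d) (cos t) (sin t) => cC sC cd sd' ct st.
  move: (z.1) (z.2) => z1 z2 sd0 cd2 cC2.
  field: cd2 cC2.
  by rewrite gt_eqF.
rewrite !ut dotpZl dotpZl p_left p_right.
have := yH i; have := yH i.+1; have := cos_half.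
move: (dotp y _) (dotp y _) => Y1 Y0 ch h1 h0.
apply: lerD.
  by rewrite ler_wpM2l// ler_wpM2l// ltW.
by rewrite ler_wpM2l// ler_wpM2l// ltW.
Qed.

End from_support_numbers.

(** * Approximation of sets of diameter at most one *)

Section approximation.
Variable R : realType.
Implicit Types (x y : plane R) (K : set (plane R)).

Lemma eucl_dist_diam K x y : (diam K <= 1)%E -> K x -> K y -> eucl_dist x y <= 1.
Proof.
move=> dK Kx Ky; rewrite -lee_fin; apply: le_trans dK.
by apply: ereal_sup_ubound; exists (x, y).
Qed.

Lemma support_fun_width K t : compact K -> K !=set0 -> (diam K <= 1)%E ->
  0 <= support_fun K t + support_fun K (t + pi) <= 1.
Proof.
move=> cK K0 dK.
have [x Kx [-> xmax]] := support_fun_max t cK K0.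
have [y Ky [-> _]] := support_fun_max (t + pi) cK K0.
have -> : dotp y (udir (t + pi)) = - dotp y (udir t).
  by rewrite udirDpi dotpC dotpNl dotpC.
rewrite subr_ge0 xmax//= -dotpBl (le_trans _ (eucl_dist_diam dK Kx Ky))//.
exact: dotp_udir_le.
Qed.

(** The outer two directions sum to [cos d *+ 2] times the middle one; testing all three on a point
    extremal for the middle direction gives the inequality. *)
Lemma support_fun_trisect K t (d : R) : compact K -> K !=set0 -> 0 <= cos d ->
  cos d *+ 2 * support_fun K (t + d) <= support_fun K t + support_fun K (t + d + d).
Proof.
move=> cK K0 cd.
have [x Kx [-> _]] := support_fun_max (t + d) cK K0.
have := support_fun_ge t cK Kx; have := support_fun_ge (t + d + d) cK Kx.
suff -> : cos d *+ 2 * dotp x (udir (t + d)) = dotp x (udir t) + dotp x (udir (t + d + d)).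
  by move=> h1 h2; exact: lerD.
rewrite -{2}(addrK d t) /dotp /udir /=; move: (t + d) => s.
rewrite cosB sinB cosD sinD; move: (x.1) (x.2) => x1 x2; ring.
Qed.

Lemma reuleaux_approximation K (N : nat) (e : R) :
  K !=set0 -> compact K -> (diam K <= 1)%E -> (1 < N)%N -> 0 < e < 1 ->
  exists2 K', Rn N.*2.+1 K' &
    forall x, K x -> K' (((1 - e) * cos (pi / N%:R / 2)) *: x).
Proof.
move=> K0 cK dK N1 /andP[e0 e1].
set d := pi / N%:R.
have N0 : 0 < N%:R :> R by rewrite ltr0n; lia.
have pi0 := pi_gt0 R.
have Nd : N%:R * d = pi by rewrite /d mulrC divfK ?gt_eqF.
have d0 : 0 < d by rewrite divr_gt0.
have d2 : d <= pi / 2.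
  by rewrite /d ler_pM2l// lef_pV2 ?posrE// ler_nat.
have cd0 : 0 <= cos d by apply: cos_ge0_pihalf; lra.
have cd1 : cos d < 1.
  by rewrite -(cos0 R) ltr_cos ?in_itv/= ?lexx ?(ltW d0) ?(ltW pi0)//; lra.
pose cen := @cell_center R N.
have cenS i : cen i.+1 = cen i + d by rewrite /cen /cell_center -natr1 -/d; ring.
have cenN i : cen (i + N)%N = cen i + pi by rewrite /cen /cell_center natrD -/d -Nd; ring.
pose g i := support_fun K (cen i).
have [] := @discrete_completion R N (cos d) g (ltnW N1) cd1.
- by move=> i; rewrite /g !cenN -addrA -mulr2n -(support_funD2pi _ (cen i) 1).
- by move=> i; rewrite /g !cenS; exact: support_fun_trisect.
- by move=> i; rewrite /g cenN; exact: support_fun_width.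
move=> h [h_per gh h_convex h_width].
(* Mixing with the disk of radius [1 / 2] keeps the widths equal to one and makes convexity strict,
   since [e * cos d < e]. *)
pose H i := (1 - e) * h i + e / 2.
have [||b [q [[b0 b_lt b_per q_step q_per0] incl]]] :=
    @reuleaux_of_support_numbers R N H N1.
- move=> i; have hN : h (i + N)%N = 1 - h i by have := h_width i; lra.
  by rewrite /H hN; lra.
- move=> i; rewrite -/d /H.
  have : (1 - e) * (cos d *+ 2 * h i.+1) <= (1 - e) * (h i + h i.+2).
    by rewrite ler_wpM2l// subr_ge0 ltW.
  by have : e * cos d < e; [rewrite gtr_pMr|lra].
(* The disk part leaves room for a perturbation [z]: with [z = 0] this yields the inclusion, with
   small [z] an interior point. *)
have inK x z : K x -> (forall t, dotp z (udir t) <= e / 2) ->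
    reuleaux b q (cos (d / 2) *: ((1 - e) *: x + z)).
  move=> Kx ze; apply: incl => i; rewrite dotpDl dotpZl /H lerD//.
  by rewrite ler_wpM2l ?subr_ge0 ?(ltW e1)// (le_trans _ (gh i))// support_fun_ge.
exists (reuleaux b q); last first.
  move=> x Kx; rewrite mulrC -scalerA -[_ *: x]addr0; apply: inK => // t.
  by rewrite /dotp /= !mul0r addr0 ltW// divr_gt0.
have n_odd : odd N.*2.+1 by rewrite /= odd_double.
apply: Rn_reuleaux => //.
have [x Kx] := K0.
have c0 : 0 < cos (d / 2) by apply: cos_gt0_pihalf; lra.
exists (cos (d / 2) *: ((1 - e) *: x)).
(* Balls are for the sup norm: both coordinates of [z] are at most [e / 4] in absolute value, so
   [dotp z (udir t) <= e / 2]. *)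
apply/nbhs_ballP; exists (cos (d / 2) * (e / 4)) => /=.
  by rewrite mulr_gt0// divr_gt0.
move=> y [/= y1 y2].
pose z : plane R := (cos (d / 2))^-1 *: y - (1 - e) *: x.
have -> : y = cos (d / 2) *: ((1 - e) *: x + z).
  by rewrite /z addrC subrK scalerA divff ?scale1r// gt_eqF.
apply: inK => // t.
have zE (u v w : R) : `|w * u - v| < w * (e / 4) -> 0 < w -> `|w^-1 * v - u| <= e / 4.
  move=> uv w0; rewrite -(ler_pM2l w0) -{1}(gtr0_norm w0) -normrM.
  by rewrite mulrBr mulrA divff ?gt_eqF// mul1r distrC ltW.
have z1 := zE _ _ _ y1 c0; have z2 := zE _ _ _ y2 c0.
have zt (u v : R) : `|u| <= e / 4 -> `|v| <= 1 -> u * v <= e / 4.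
  move=> ue v1; apply: le_trans (ler_norm _) _; rewrite normrM.
  by rewrite (le_trans _ ue)// ler_piMr.
have := lerD (zt _ _ z1 (cos_max t)) (zt _ _ z2 (sin_max t)).
by move=> /le_trans; apply; lra.
Qed.

End approximation.

(** * Area and dilations *)

Section area_scaling.
Variable R : realType.
Notation mu := (@lebesgue_measure R).
Notation mR := (measurableTypeR R).

(** The right side is a scaled pushforward measure that agrees with Lebesgue measure on half-open
    intervals, hence everywhere by uniqueness. *)
Lemma lebesgue_measure_dilate (l : R) (A : set mR) : 0 < l -> measurable A ->
  (mu A = l%:E * mu (( *%R l : mR -> mR) @^-1` A))%E.
Proof.
move=> l0 mA; pose l' : {nonneg R} := NngNum (ltW l0).
have mf : measurable_fun [set: mR] ( *%R l : mR -> mR) by exact: mulrl_measurable.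
pose P := measure_function_pushforward__canonical__measure_function_Measure mu mf.
pose m := measure_function_mscale__canonical__measure_function_Measure l' P.
apply: (@lebesgue_measure_unique R m) => // _ [[a b]] _ <-.
change (mu `]a, b]%classic = l%:E * mu (( *%R l : mR -> mR) @^-1` `]a, b]%classic))%E.
rewrite (_ : _ @^-1` _ = `]a / l, b / l]%classic); last first.
  by apply/seteqP; split => x /=; rewrite !in_itv/= ltr_pdivrMr// ler_pdivlMr// (mulrC l).
rewrite !lebesgue_measure_itv/= !lte_fin ltr_pM2r ?invr_gt0//.
case: ifPn => ab; last by rewrite mule0.
by rewrite -EFinD -EFinM -mulrBl mulrC divfK ?gt_eqF.
Qed.

(** Same argument on rectangles, through uniqueness of the product measure. *)
Lemma area_dilate (l : R) (A : set (mR * mR)) : 0 < l -> measurable A ->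
  area (A : set (plane R)) =
  ((l ^+ 2)%:E * area ((fun x : plane R => l *: x) @^-1` A))%E.
Proof.
move=> l0 mA; pose l' : {nonneg R} := NngNum (exprn_ge0 2 (ltW l0)).
pose f (x : mR * mR) : mR * mR := (l * x.1, l * x.2).
have mf : measurable_fun [set: mR * mR] f.
  apply: measurable_fun_pair.
    exact: (measurableT_comp (@mulrl_measurable R setT l) measurable_fst).
  exact: (measurableT_comp (@mulrl_measurable R setT l) measurable_snd).
pose P := measure_function_pushforward__canonical__measure_function_Measure (mu \x mu)%E mf.
suff H : (mu \x mu)%E A = mscale l' P A by exact: H.
apply: product_measure_unique => // X Y mX mY.
change ((l ^+ 2)%:E * (mu \x mu) ((( *%R l : mR -> mR) @^-1` X) `*`
  (( *%R l : mR -> mR) @^-1` Y)) = mu X * mu Y)%E.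
have mM (Z : set mR) : measurable Z -> measurable (( *%R l : mR -> mR) @^-1` Z).
  by move=> mZ; rewrite -[X in measurable X]setTI; exact: (@mulrl_measurable R setT l).
rewrite product_measure1E; [|exact: mM..].
rewrite (lebesgue_measure_dilate l0 mX) (lebesgue_measure_dilate l0 mY).
by rewrite expr2 EFinM muleACA.
Qed.

(** Links the product topology to the product sigma-algebra: the complement is a countable union of
    open boxes with rational corners. *)
Lemma closed_plane_measurable (U : set (plane R)) :
  closed U -> measurable (U : set (mR * mR)).
Proof.
move=> cU; rewrite -[U]setCK; apply: measurableC.
pose box (q : rat * rat * (rat * rat)) : set (plane R) :=
  `]ratr q.1.1, ratr q.1.2[%classic `*` `]ratr q.2.1, ratr q.2.2[%classic.
have -> : ~` U = \bigcup_q (if `[< box q `<=` ~` U >] then box q else set0).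
  apply/seteqP; split => [x Ux|x [q _]]; last first.
    by case: asboolP => // bq qx; exact: bq.
  have : nbhs x (~` U) by apply: open_nbhs_nbhs; split => //; rewrite openC.
  move=> /nbhs_ballP[r /= r0 rU].
  have itv (z : R) : exists a b : rat,
      [/\ ratr a < z, z < ratr b, z - r < ratr a & ratr b < z + r].
    have [|a] := @rat_in_itvoo R (z - r) z; first by lra.
    have [|c] := @rat_in_itvoo R z (z + r); first by lra.
    by rewrite !in_itv/= => /andP[c1 c2] /andP[a1 a2]; exists a, c.
  have [a1 [c1 [a1x c1x a1r c1r]]] := itv x.1.
  have [a2 [c2 [a2x c2x a2r c2r]]] := itv x.2.
  exists ((a1, c1), (a2, c2)) => //; case: asboolP => [_|]; last first.
    case; move=> y [/=]; rewrite !in_itv/= => /andP[y1 y1'] /andP[y2 y2'].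
    by apply: rU; split => /=; rewrite /ball/= ltr_norml; lra.
  by split; rewrite /= in_itv/= ?a1x ?a2x.
apply: countable_bigcupT_measurable => [|q]; first exact: countableP.
case: ifPn => // _.
by apply: measurableX; exact: measurable_itv.
Qed.
End area_scaling.

(** * Comparison of the covering values *)

Section universal_family.
Variable R : realType.
Implicit Types (x y : plane R) (K U : set (plane R)).

Lemma polar x : exists t, x = eucl_dist x 0 *: udir t.
Proof.
rewrite /eucl_dist subr0; set r := Num.sqrt _.
have r2 : r ^+ 2 = x.1 ^+ 2 + x.2 ^+ 2.
  by rewrite sqr_sqrtr /dotp ?addr_ge0 -?expr2 ?sqr_ge0// -!expr2.
have [r0|r0] := eqVneq r 0.
  exists 0; rewrite r0 scale0r; move: r2; rewrite r0 expr0n/= => /esym/eqP.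
  rewrite paddr_eq0 ?sqr_ge0// !sqrf_eq0 => /andP[/eqP x1 /eqP x2].
  by rewrite [LHS]surjective_pairing x1 x2.
have rpos : 0 < r by rewrite lt_neqAle eq_sym r0 sqrtr_ge0.
pose a := x.1 / r; pose c := x.2 / r.
have ac : a ^+ 2 + c ^+ 2 = 1 by rewrite !expr_div_n -mulrDl -r2 divff// expf_neq0.
have a1 : -1 <= a <= 1.
  by have c2 := sqr_ge0 c; apply/andP; split; nra.
have xE s : cos s = a -> sin s = c -> x = r *: udir s.
  move=> cs sn; rewrite /udir cs sn [LHS]surjective_pairing /a /c.
  by congr (_, _); rewrite /GRing.scale /= mulrC divfK.
have sE : Num.sqrt (1 - a ^+ 2) = `|c| by rewrite -sqrtr_sqr; congr Num.sqrt; lra.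
have [c0|c0] := leP 0 c.
  by exists (acos a); apply: xE; rewrite ?acosK ?in_itv//= sin_acos// sE ger0_norm.
exists (- acos a); apply: xE; rewrite ?cosN ?sinN ?acosK ?in_itv//= sin_acos// sE ltr0_norm//.
by rewrite opprK.
Qed.

Lemma diam_le1 K : (forall x y, K x -> K y -> eucl_dist x y <= 1) -> (diam K <= 1)%E.
Proof. by move=> K1; apply: ge_ereal_sup => _ [[x y] [/= Kx Ky] <-]; rewrite lee_fin K1. Qed.

(** The distance of two points is at most the width in the direction that joins them. *)
Lemma W1_diam K : W1 K -> (diam K <= 1)%E.
Proof.
case=> -[cK _ _] wK; apply: diam_le1 => x y Kx Ky.
have [t xyE] := polar (x - y).
have -> : eucl_dist x y = dotp (x - y) (udir t).
  by rewrite [in RHS]xyE dotpZl dotp_udir subrr cos0 mulr1 /eucl_dist subr0.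
rewrite -(wK t) dotpBl lerD ?support_fun_ge//.
have := support_fun_ge (t + pi) cK Ky.
by rewrite udirDpi dotpC dotpNl dotpC.
Qed.

Lemma disk_diam : (diam (@disk R) <= 1)%E.
Proof.
apply: diam_le1 => x y; rewrite /disk /= /eucl_dist !subr0 => x1 y1.
have half2 (z : plane R) : Num.sqrt (dotp z z) <= 2^-1 -> dotp z z <= 4^-1.
  move=> z1; have z0 : 0 <= dotp z z by rewrite /dotp addr_ge0// -expr2 sqr_ge0.
  rewrite -(sqr_sqrtr z0) (_ : 4^-1 = 2^-1 ^+ 2); last by field.
  by rewrite ler_sqr ?nnegrE ?sqrtr_ge0.
rewrite -[1]sqrtr1 ler_wsqrtr//.
have := half2 _ x1; have := half2 _ y1; rewrite /dotp /= => y2 x2.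
(* This is [|x - y|^2 <= 2 |x|^2 + 2 |y|^2], coordinate by coordinate. *)
have := sqr_ge0 (x.1 + y.1); have := sqr_ge0 (x.2 + y.2); nra.
Qed.

Lemma disk_compact : compact (@disk R).
Proof.
apply: (@compact_plane _ _ 1).
  have -> : @disk R = (fun x : plane R => x.1 * x.1 + x.2 * x.2) @^-1` [set r | r <= 4^-1].
    apply/seteqP; split => x; rewrite /disk /= /eucl_dist subr0 -/(dotp x x).
      move=> x1; have z0 : 0 <= dotp x x by rewrite /dotp addr_ge0// -expr2 sqr_ge0.
      rewrite -(sqr_sqrtr z0) (_ : 4^-1 = 2^-1 ^+ 2); last by field.
      by rewrite ler_sqr ?nnegrE ?sqrtr_ge0.
    move=> x1; rewrite (_ : 2^-1 = Num.sqrt (2^-1 ^+ 2)).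
      by rewrite ler_wsqrtr// (le_trans x1)//; lra.
    by rewrite sqrtr_sqr ger0_norm.
  apply: closed_comp; last exact: closed_le.
  by move=> x _; apply: cvgD; apply: cvgM; (exact: cvg_fst || exact: cvg_snd).
move=> x; rewrite /disk /= /eucl_dist subr0 /dotp -!expr2 => x1.
have le1 (v : R) : `|v| <= Num.sqrt (x.1 ^+ 2 + x.2 ^+ 2) -> `|v| <= 1.
  move=> /le_trans; apply; apply: le_trans x1 _; lra.
by split; apply: le1; rewrite -sqrtr_sqr ler_wsqrtr// ?lerDl ?lerDr sqr_ge0.
Qed.

Lemma AM_universal M :
  @AM R M `<=` [set K | [/\ K !=set0, compact K & (diam K <= 1)%E]].
Proof.
move=> K [->|[m _ [WK _]]].
  split; [|exact: disk_compact|exact: disk_diam].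
  by exists 0; rewrite /disk /= /eucl_dist subrr /dotp /= mulr0 addr0 sqrtr0.
split; last exact: W1_diam; case: WK => -[cK _ [x Kx]] _ //.
by exists x; exact: interior_subset.
Qed.

Lemma cover_value_subset (F G : set (set (plane R))) :
  F `<=` G -> (cover_value F <= cover_value G)%E.
Proof.
move=> FG; apply: ereal_inf_le_tmp => _ [U [cU vU GU] <-].
by exists U => //; split => // K /FG; exact: GU.
Qed.

Lemma Lambda_le M : (Lambda R M <= a_Leb R)%E.
Proof. by apply: cover_value_subset; exact: AM_universal. Qed.

Lemma eucl_distZ (l : R) x y : 0 <= l -> eucl_dist (l *: x) (l *: y) = l * eucl_dist x y.
Proof.
move=> l0; rewrite /eucl_dist -scalerBr dotpZl dotpC dotpZl mulrA -expr2.
by rewrite sqrtrM ?sqr_ge0// sqrtr_sqr ger0_norm.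
Qed.

Definition shrink_factor (N : nat) (e : R) : R := (1 - e) * cos (pi / N%:R / 2).

Lemma shrink_factor_gt0 N e : (1 < N)%N -> 0 < e < 1 -> 0 < shrink_factor N e.
Proof.
move=> N1 /andP[e0 e1]; rewrite mulr_gt0// ?subr_gt0//; apply: cos_gt0_pihalf.
have pi0 := pi_gt0 R; have N0 : 0 < N%:R :> R by rewrite ltr0n; lia.
have : pi / N%:R <= pi / 2 :> R by rewrite ler_pM2l// lef_pV2 ?posrE// ler_nat.
have : 0 < pi / N%:R :> R by rewrite divr_gt0.
lra.
Qed.

Lemma a_Leb_le_Lambda N M e : (1 < N <= M)%N -> 0 < e < 1 ->
  ((shrink_factor N e ^+ 2)%:E * a_Leb R <= Lambda R M)%E.
Proof.
move=> /andP[N1 NM] e01; have l0 := shrink_factor_gt0 N1 e01.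
set l := shrink_factor N e in l0 *.
apply: le_ereal_inf_tmp => _ [U [cU vU covU] <-].
have cl := closed_compact_plane cU.
(* The preimage of [U] under multiplication by [l] is the enlarged cover, with area [l ^- 2] times
   that of [U]. *)
rewrite (area_dilate l0 (closed_plane_measurable cl)).
rewrite lee_pmul2l ?lte_fin ?exprn_gt0//.
apply: ereal_inf_lbound; eexists; last by [].
have preE : (fun x : plane R => l *: x) @^-1` U = (fun x : plane R => l^-1 *: x) @` U.
  apply/seteqP; split => [x Ux|_ [x Ux <-]].
    by exists (l *: x) => //; rewrite scalerA mulVf ?scale1r// gt_eqF.
  by rewrite /= scalerA divff ?scale1r// gt_eqF.
split.
- rewrite preE; apply: continuous_compact => //; apply: continuous_subspaceT.
  exact: scaler_continuous.
- apply/convex_planeP => x y a Ux Uy a01 /=.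
  move/convex_planeP: vU => /(_ _ _ a Ux Uy a01).
  by rewrite scalerDr !scalerA mulrC [(1 - a) * l]mulrC.
- move=> K [K0 cK dK].
  have [K' RK' KK'] := reuleaux_approximation K0 cK dK N1 e01.
  have [|g ig gU] := covU K'; first by right; exists N => //=; lia.
  (* Conjugating [g] with the dilation gives an isometry that places [K] itself in the enlarged
     cover. *)
  exists (fun x => l^-1 *: g (l *: x)).
    move=> x y; rewrite eucl_distZ ?invr_ge0 ?(ltW l0)// ig eucl_distZ ?(ltW l0)//.
    by rewrite mulKf// gt_eqF.
  move=> _ [x Kx <-] /=; rewrite scalerA divff ?gt_eqF// scale1r.
  by apply: gU; exists (l *: x) => //; exact: KK'.
Qed.

Lemma a_Leb_ge0 : (0 <= a_Leb R)%E.
Proof. by apply: le_ereal_inf_tmp => _ [U _ <-]; exact: measure_ge0. Qed.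

(** Diagonal choice: the number of directions grows with [M] while the weight of the disk tends to
    zero. *)
Lemma shrink_factor_cvg :
  shrink_factor M (M.+1%:R^-1 / 2) @[M --> \oo] --> (1 : R).
Proof.
have inv0 : (M%:R^-1 : R) @[M --> \oo] --> (0 : R).
  by rewrite -cvg_shiftS; exact: cvg_harmonic.
rewrite -[X in _ --> X]mulr1; apply: cvgM.
  rewrite -[X in _ --> X]subr0 -(mul0r (2^-1 : R)); apply: cvgB; first exact: cvg_cst.
  by apply: cvgM; [exact: cvg_harmonic|exact: cvg_cst].
rewrite -[X in _ --> X](cos0 R).
have inner : (pi / M%:R / 2 : R) @[M --> \oo] --> (0 : R).
  rewrite -(mul0r (2^-1 : R)) -(mulr0 (pi : R)); apply: cvgM; last exact: cvg_cst.
  by apply: cvgM; [exact: cvg_cst|exact: inv0].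
exact: (cvg_comp _ _ inner (@continuous_cos R 0)).
Qed.

Lemma Lambda_cvg : Lambda R M @[M --> \oo] --> a_Leb R.
Proof.
have e01 M : 0 < (M.+1%:R^-1 / 2 : R) < 1.
  have half (v : R) : 0 < v -> v <= 1 -> 0 < v / 2 < 1.
    by move=> v0 v1; apply/andP; split; lra.
  by apply: half; rewrite ?invf_le1 ?invr_gt0 ?ltr0n// ler1n.
have lower M : (1 < M)%N ->
    ((shrink_factor M (M.+1%:R^-1 / 2) ^+ 2)%:E * a_Leb R <= Lambda R M)%E.
  by move=> M1; apply: a_Leb_le_Lambda => //; rewrite M1 leqnn.
apply: (@squeeze_cvge _ _ _ _
  (fun M => (shrink_factor M (M.+1%:R^-1 / 2) ^+ 2)%:E * a_Leb R)%E _ (fun=> a_Leb R)).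
- near=> M; rewrite Lambda_le andbT; apply: lower.
  by near: M; exact: nbhs_infty_gt.
(* For a finite value the lower bounds converge by continuity of multiplication; for [+oo] they are
   eventually constant; [-oo] is excluded by nonnegativity. *)
- case: (a_Leb R) a_Leb_ge0 lower => [r r0 _|_ lower|//].
    apply: cvg_EFin; first exact: nearW.
    have := cvgM shrink_factor_cvg shrink_factor_cvg; rewrite mulr1 => sq.
    by rewrite -[X in _ --> X](mul1r r); apply: cvgMr_tmp; exact: sq.
  apply: cvg_near_cst; near=> M.
  rewrite gt0_muley// lte_fin exprn_gt0// shrink_factor_gt0//.
  by near: M; exact: nbhs_infty_gt.
- exact: cvg_cst.
Unshelve. all: by end_near.
Qed.

End universal_family.

Unset Implicit Arguments.

Theorem theoremS5p8 (R : realType) : Lambda R M @[M --> \oo] --> a_Leb R.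
Proof. exact: Lambda_cvg. Qed.
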